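(* Let $H$ be a semisimple Hopf algebra over an algebraically closed field $k$ of characteristic zero and let $K$ be a normal Hopf subalgebra of $H$. With the notation of the context, for all $0\le i,j\le s$ one has $$a_ia_j=\sum_{k=0}^{s}N^k_{ij}\,a_k$$ for some rational numbers $N^k_{ij}\ge 0$. Moreover, for all $i,j,k$, $$N^k_{ij}\,a_k(1)=N^{i^*}_{jk^*}\,a_{i^*}(1).$$
   Context: $K\subseteq H$ is a Hopf subalgebra which is normal, i.e. $\sum h_1 x S(h_2)\in K$ for all $h\in H$, $x\in K$ (Sweedler notation, $S$ the antipode). $\mathrm{Irr}(H)$ denotes the set of irreducible characters of $H$, and $C(H)\subseteq H^*$ the character algebra (span of characters, with the product of $H^*$). For a character $\chi$, $\chi^*=\chi\circ S$ is the character of the dual module. Define an equivalence relation on $\mathrm{Irr}(H)$ by $\chi\sim\mu$ iff the restrictions $\chi\downarrow_K$ and $\mu\downarrow_K$ have a common irreducible constituent (this is an equivalence relation). Let $\mathcal{A}_0,\dots,\mathcal{A}_s$ be the equivalence classes, with $\mathcal{A}_0$ the class of the trivial character $\epsilon_H$, and put $a_i=\sum_{\chi\in\mathcal{A}_i}\chi(1)\chi\in C(H)$. The set $\{\chi^*:\chi\in\mathcal{A}_i\}$ is again an equivalence class; it is denoted $\mathcal{A}_{i^*}$, which defines an involution $i\mapsto i^*$ on $\{0,\dots,s\}$. *)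

(* Defs.v *)
(* Finite-dimensional Hopf algebras over a field F are
   presented in coordinates: H = 'rV[F]_n with basis bvec i (i : 'I_n) and
   structure tensors for multiplication, unit, comultiplication, counit and
   antipode.  An element of H (x) H is an n x n matrix T, T a b being the
   coefficient of e_a (x) e_b. *)
From HB Require Import structures.
From mathcomp Require Import all_boot all_order all_algebra.
Set Implicit Arguments. Unset Strict Implicit. Unset Printing Implicit Defensive.
Import Order.TTheory GRing.Theory Num.Theory.
Local Open Scope ring_scope.

Record hopf_data (F : fieldType) (n : nat) := HopfData {
  hmul : 'I_n -> 'I_n -> 'rV[F]_n;
  hunit : 'rV[F]_n;
  hcomul : 'I_n -> 'M[F]_n;
  hcounit : 'I_n -> F;
  hanti : 'M[F]_n                      (* S, acting on row vectors: S h = h *m hanti *)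
}.

Section Hopf.
Variables (F : fieldType) (n : nat) (H : hopf_data F n).

Definition bvec (i : 'I_n) : 'rV[F]_n := delta_mx 0 i.
Definition mulH (h g : 'rV[F]_n) : 'rV[F]_n :=
  \sum_i \sum_j (h 0 i * g 0 j) *: hmul H i j.
Definition comulH (h : 'rV[F]_n) : 'M[F]_n := \sum_i h 0 i *: hcomul H i.
Definition counitH (h : 'rV[F]_n) : F := \sum_i h 0 i * hcounit H i.
Definition antipH (h : 'rV[F]_n) : 'rV[F]_n := h *m hanti H.
Definition tensor (x y : 'rV[F]_n) : 'M[F]_n := x^T *m y.
Definition tmul (T U : 'M[F]_n) : 'M[F]_n :=
  \sum_j \sum_k \sum_j' \sum_k' (T j k * U j' k') *:
      tensor (mulH (bvec j) (bvec j')) (mulH (bvec k) (bvec k')).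

Definition is_hopf : Prop :=
  [/\ (forall h g f, mulH (mulH h g) f = mulH h (mulH g f)) /\
      (forall h, mulH (hunit H) h = h /\ mulH h (hunit H) = h),
      (forall h a b c, \sum_j comulH h j c * hcomul H j a b
                       = \sum_k comulH h a k * hcomul H k b c),
      (forall h k, \sum_j hcounit H j * comulH h j k = h 0 k) /\
      (forall h j, \sum_k comulH h j k * hcounit H k = h 0 j),
      ((forall h g, comulH (mulH h g) = tmul (comulH h) (comulH g)) /\
        comulH (hunit H) = tensor (hunit H) (hunit H)) /\
      ((forall h g, counitH (mulH h g) = counitH h * counitH g) /\
        counitH (hunit H) = 1) &
      (forall h, \sum_j \sum_k comulH h j k *: mulH (antipH (bvec j)) (bvec k)
                   = counitH h *: hunit H /\
                 \sum_j \sum_k comulH h j k *: mulH (bvec j) (antipH (bvec k))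
                   = counitH h *: hunit H)].

Definition left_ideal (U : 'M[F]_n) : Prop :=
  forall h u, (u <= U)%MS -> (mulH h u <= U)%MS.
Definition semisimple : Prop :=
  forall U : 'M[F]_n, left_ideal U ->
    exists V : 'M[F]_n, left_ideal V /\
      (U + V == 1%:M)%MS /\ (U :&: V)%MS == 0.

Definition is_hopf_subalg (K : 'M[F]_n) : Prop :=
  [/\ (hunit H <= K)%MS,
      (forall x y, (x <= K)%MS -> (y <= K)%MS -> (mulH x y <= K)%MS),
      (forall x, (x <= K)%MS -> (comulH x <= K)%MS /\ ((comulH x)^T <= K)%MS) &
      (forall x, (x <= K)%MS -> (antipH x <= K)%MS)].

Definition adH (h x : 'rV[F]_n) : 'rV[F]_n :=
  \sum_j \sum_k comulH h j k *: mulH (mulH (bvec j) x) (antipH (bvec k)).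
Definition normal_subalg (K : 'M[F]_n) : Prop :=
  forall h x, (x <= K)%MS -> (adH h x <= K)%MS.

(* representations (given on the basis, extended linearly) of the subalgebra
   with underlying space A (A = 1%:M for H itself) *)
Definition repv d (rho : 'I_n -> 'M[F]_d) (h : 'rV[F]_n) : 'M[F]_d :=
  \sum_i h 0 i *: rho i.
Definition is_rep_on (A : 'M[F]_n) d (rho : 'I_n -> 'M[F]_d) : Prop :=
  repv rho (hunit H) = 1%:M /\
  forall h g, (h <= A)%MS -> (g <= A)%MS ->
    repv rho (mulH h g) = repv rho h *m repv rho g.
Definition irreducible_on (A : 'M[F]_n) d (rho : 'I_n -> 'M[F]_d) : Prop :=
  (0 < d)%N /\
  forall U : 'M[F]_d,
    (forall h, (h <= A)%MS -> (U *m repv rho h <= U)%MS) ->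
    \rank U = 0%N \/ \rank U = d.

(* characters, as elements of H^* given by their values on the basis *)
Definition charv d (rho : 'I_n -> 'M[F]_d) : 'rV[F]_n := \row_i \tr (rho i).
Definition chev (chi h : 'rV[F]_n) : F := \sum_i h 0 i * chi 0 i.
Definition is_irr_char (chi : 'rV[F]_n) : Prop :=
  exists d (rho : 'I_n -> 'M[F]_d),
    [/\ is_rep_on 1%:M rho, irreducible_on 1%:M rho & chi = charv rho].

(* chi|_K and mu|_K have a common irreducible constituent theta:
   theta is the character of an irreducible K-module and chi|_K - theta,
   mu|_K - theta are characters of K-modules *)
Definition res_meet (K : 'M[F]_n) (chi mu : 'rV[F]_n) : Prop :=
  exists d (sigma : 'I_n -> 'M[F]_d),
    [/\ is_rep_on K sigma, irreducible_on K sigma,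
        (exists d1 (tau : 'I_n -> 'M[F]_d1), is_rep_on K tau /\
           forall x, (x <= K)%MS ->
             chev chi x = chev (charv sigma) x + chev (charv tau) x) &
        (exists d2 (tau : 'I_n -> 'M[F]_d2), is_rep_on K tau /\
           forall x, (x <= K)%MS ->
             chev mu x = chev (charv sigma) x + chev (charv tau) x)].

Definition dmul (chi mu : 'rV[F]_n) : 'rV[F]_n :=
  \row_i \sum_j \sum_k hcomul H i j k * chi 0 j * mu 0 k.
Definition dualch (chi : 'rV[F]_n) : 'rV[F]_n :=
  \row_i chev chi (antipH (bvec i)).
Definition epsv : 'rV[F]_n := \row_i hcounit H i.

End Hopf.

(* Main.v *)
Require Import Defs.
From HB Require Import structures.
From mathcomp Require Import all_boot all_order all_algebra all_field.
From mathcomp Require Import mxtens zify ring.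
From Stdlib Require Import Classical.
Set Implicit Arguments. Unset Strict Implicit. Unset Printing Implicit Defensive.
Import Order.TTheory GRing.Theory Num.Theory.
Local Open Scope ring_scope.

(* A nonzero right integral t of K exists because the trivial module embeds in
   K (x) K^*, which is free.  Normality and semiprimeness of H force eps(t) <> 0
   and t central, so H and K have central idempotent integrals L and e with e
   in K.  The functional tau(f) = f(L) turns Schur's lemma into the
   orthogonality relations tau(chi^* psi) = tau(chi psi^* ) = delta, which also
   give chi^** = chi and make tau a trace on the character algebra.

   The numbers M(mu, chi) = (mu^* chi)(e) are traces of idempotents, hence
   natural numbers, and M(mu, chi) <> 0 iff mu and chi have a common constituent
   on K.  Since f(e) = tau(a_0 f), they are the matrix of multiplication by a_0:
   chi a_0 = sum_mu M(mu, chi) mu.  As a_0^2 = a_0(1) a_0 and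
   (sum chi(1) chi) a_0 = a_0(1) sum chi(1) chi, each diagonal block of M is a
   positive matrix having both its own columns and the degree vector as
   eigenvectors for a_0(1); by Perron-Frobenius chi a_0 is proportional to the
   a_i with chi in A_i.  So f a_0 is a combination of the a_k for every f, and
   a_i a_j = a_i a_j a_0 / a_0(1).  Finally
   N_ij^k a_k(1) = tau(a_k^* a_i a_j), which is cyclically symmetric. *)

(** * Linear maps and Sweedler sums *)

Section Linearity.
Variable F : fieldType.

(** The Hopf axioms give neither bijectivity of S nor S^2 = 1. So the left and right averages over
    an integral are kept apart: each yields its own orthogonality relation, and chi^** = chi comes
    from comparing the two. Surjectivity of S, which makes the dual of an irreducible representation
    irreducible, is extracted from an integral of H as well.

    A K-stable subspace is split off by an idempotent that need not be K-linear, so the argument on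
    K runs through composition factors and additivity of characters rather than direct sums of
    modules.

    F carries no order, whereas Perron-Frobenius and the sign of N need one. Every quantity involved
    is therefore first recognized as a natural number (a dimension, or the rank of an idempotent),
    compared in [rat], and sent back to F, where characteristic zero makes the passage faithful. *)

Definition lin (U V : lmodType F) (f : U -> V) :=
  forall a x y, f (a *: x + y) = a *: f x + f y.

Definition bilin (U V W : lmodType F) (f : U -> V -> W) :=
  (forall y, lin (fun x => f x y)) /\ (forall x, lin (f x)).

Variables U V W : lmodType F.

Lemma linD (f : U -> V) x y : lin f -> f (x + y) = f x + f y.
Proof. by move=> lf; rewrite -[x]scale1r lf !scale1r. Qed.

Lemma lin0 (f : U -> V) : lin f -> f 0 = 0.
Proof. by move=> lf; apply: (@addrI _ (f 0)); rewrite -linD // !addr0. Qed.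

Lemma linZ (f : U -> V) a x : lin f -> f (a *: x) = a *: f x.
Proof. by move=> lf; rewrite -[a *: x]addr0 lf lin0 // addr0. Qed.

Lemma linN (f : U -> V) x : lin f -> f (- x) = - f x.
Proof. by move=> lf; rewrite -scaleN1r linZ // scaleN1r. Qed.

Lemma linB (f : U -> V) x y : lin f -> f (x - y) = f x - f y.
Proof. by move=> lf; rewrite linD // linN. Qed.

Lemma lin_sum (f : U -> V) I (r : seq I) P E :
  lin f -> f (\sum_(i <- r | P i) E i) = \sum_(i <- r | P i) f (E i).
Proof.
by move=> lf; rewrite (big_morph f (fun x y => linD x y lf) (lin0 lf)).
Qed.

Lemma lin_id : lin (fun x : U => x).
Proof. by []. Qed.

Lemma lin_comp (g : V -> W) (f : U -> V) :
  lin g -> lin f -> lin (fun x => g (f x)).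
Proof. by move=> lg lf a x y; rewrite lf lg. Qed.

Lemma lin_scale c (f : U -> V) : lin f -> lin (fun x => c *: f x).
Proof. by move=> lf a x y; rewrite lf scalerDr !scalerA mulrC. Qed.

Lemma lin_scalel (g : U -> F^o) (v : V) : lin g -> lin (fun x => g x *: v).
Proof. by move=> lg a x y; rewrite lg scalerDl scalerA. Qed.

Lemma lin_bigsum I (r : seq I) P (f : I -> U -> V) :
  (forall i, lin (f i)) -> lin (fun x => \sum_(i <- r | P i) f i x).
Proof.
move=> lf a x y; rewrite scaler_sumr -big_split; apply: eq_bigr => i _.
exact: lf.
Qed.

Lemma lin_mulmxl m n p (f : U -> 'M[F]_(m, n)) (B : 'M[F]_(n, p)) :
  lin f -> lin (fun x => f x *m B).
Proof. by move=> lf a x y; rewrite lf mulmxDl scalemxAl. Qed.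

Lemma lin_mulmxr m n p (f : U -> 'M[F]_(n, p)) (B : 'M[F]_(m, n)) :
  lin f -> lin (fun x => B *m f x).
Proof. by move=> lf a x y; rewrite lf mulmxDr scalemxAr. Qed.

Lemma lin_trmx m n (f : U -> 'M[F]_(m, n)) : lin f -> lin (fun x => (f x)^T).
Proof. by move=> lf a x y; rewrite lf linearP. Qed.

Lemma lin_mxtrace m (f : U -> 'M[F]_m) :
  lin f -> lin (fun x => \tr (f x) : F^o).
Proof. by move=> lf a x y; rewrite lf linearP. Qed.

Lemma lin_entry m n (f : U -> 'M[F]_(m, n)) i j :
  lin f -> lin (fun x => f x i j : F^o).
Proof. by move=> lf a x y; rewrite lf !mxE. Qed.

Lemma lin_tensl m n p q (f : U -> 'M[F]_(m, n)) (B : 'M[F]_(p, q)) :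
  lin f -> lin (fun x => f x *t B).
Proof.
by move=> lf a x y; rewrite lf; apply/matrixP => i j; rewrite !mxE mulrDl mulrA.
Qed.

Lemma lin_tensr m n p q (f : U -> 'M[F]_(m, n)) (B : 'M[F]_(p, q)) :
  lin f -> lin (fun x => B *t f x).
Proof.
move=> lf a x y; rewrite lf; apply/matrixP => i j.
by rewrite !mxE mulrDr mulrCA.
Qed.

Lemma lin_mulFl (f : U -> F^o) (b : F) : lin f -> lin (fun x => f x * b : F^o).
Proof. by move=> lf a x y; rewrite lf mulrDl -mulrA. Qed.

Lemma lin_mulFr (f : U -> F^o) (b : F) : lin f -> lin (fun x => b * f x : F^o).
Proof. by move=> lf a x y; rewrite lf mulrDr mulrCA. Qed.

End Linearity.

Section Sweedler.
Variables (F : fieldType) (n : nat) (H : hopf_data F n).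
Local Notation vec := 'rV[F]_n.
Local Notation "x ** y" := (mulH H x y) (at level 40, left associativity).
Local Notation S := (antipH H).
Local Notation eps := (counitH H).
Local Notation one := (hunit H).

Lemma vecE (x : vec) : x = \sum_i x 0 i *: bvec F i.
Proof. exact: row_sum_delta. Qed.

Lemma bvecE (i j : 'I_n) : bvec F i 0 j = (j == i)%:R.
Proof. by rewrite mxE eqxx. Qed.

Lemma sum_bvec (V : lmodType F) i (E : 'I_n -> V) :
  \sum_j bvec F i 0 j *: E j = E i.
Proof.
rewrite (bigD1 i) //= bvecE eqxx scale1r big1 ?addr0 // => j ne_ji.
by rewrite bvecE (negbTE ne_ji) scale0r.
Qed.

Lemma linE (V : lmodType F) (f : vec -> V) x :
  lin f -> f x = \sum_i x 0 i *: f (bvec F i).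
Proof.
by move=> lf; rewrite {1}[x]vecE lin_sum //; apply: eq_bigr => i _; rewrite linZ.
Qed.

Lemma lin_mull (U : lmodType F) (f : U -> vec) y :
  lin f -> lin (fun x => f x ** y).
Proof.
move=> lf a x z; rewrite lf /mulH scaler_sumr -big_split; apply: eq_bigr => i _.
rewrite scaler_sumr -big_split; apply: eq_bigr => j _ /=.
by rewrite !mxE mulrDl scalerDl scalerA mulrA.
Qed.

Lemma lin_mulr (U : lmodType F) (f : U -> vec) y :
  lin f -> lin (fun x => y ** f x).
Proof.
move=> lf a x z; rewrite lf /mulH scaler_sumr -big_split; apply: eq_bigr => i _.
rewrite scaler_sumr -big_split; apply: eq_bigr => j _ /=.
by rewrite !mxE mulrDr scalerDl scalerA mulrCA.
Qed.

Lemma lin_antip (U : lmodType F) (f : U -> vec) : lin f -> lin (fun x => S (f x)).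
Proof. exact: lin_mulmxl. Qed.

Lemma lin_counit (U : lmodType F) (f : U -> vec) :
  lin f -> lin (fun x => eps (f x) : F^o).
Proof.
move=> lf; apply: lin_bigsum => i; apply: lin_mulFl.
exact: lin_entry.
Qed.

Lemma lin_chev (U : lmodType F) (f : U -> vec) (chi : vec) :
  lin f -> lin (fun x => chev chi (f x) : F^o).
Proof.
move=> lf; apply: lin_bigsum => i; apply: lin_mulFl.
exact: lin_entry.
Qed.

Lemma lin_repv (U : lmodType F) (f : U -> vec) d (rho : 'I_n -> 'M[F]_d) :
  lin f -> lin (fun x => repv rho (f x)).
Proof.
move=> lf; apply: lin_bigsum => i; apply: lin_scalel.
exact: lin_entry.
Qed.

Lemma lin_comul (U : lmodType F) (f : U -> vec) :
  lin f -> lin (fun x => comulH H (f x)).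
Proof.
move=> lf; apply: lin_bigsum => i; apply: lin_scalel.
exact: lin_entry.
Qed.

(** For bilinear [f] this is the linear map on H (x) H induced by [f], applied to T. Bilinearity is
    left out of the definition so that congruence and linearity in T hold for every [f]. *)
Definition swm (V : lmodType F) (T : 'M[F]_n) (f : vec -> vec -> V) : V :=
  \sum_j \sum_k T j k *: f (bvec F j) (bvec F k).

(* the Sweedler sum of f (h_1) (h_2) *)
Definition sw (V : lmodType F) (h : vec) (f : vec -> vec -> V) : V :=
  swm (comulH H h) f.

Lemma eq_swm (V : lmodType F) T (f g : vec -> vec -> V) :
  (forall a b, f a b = g a b) -> swm T f = swm T g.
Proof.
by move=> fg; apply: eq_bigr => j _; apply: eq_bigr => k _; rewrite fg.
Qed.

Lemma eq_sw (V : lmodType F) h (f g : vec -> vec -> V) :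
  (forall a b, f a b = g a b) -> sw h f = sw h g.
Proof. exact: eq_swm. Qed.

Lemma lin_swm (U V : lmodType F) (T : U -> 'M[F]_n) (f : vec -> vec -> V) :
  lin T -> lin (fun x => swm (T x) f).
Proof.
move=> lT; apply: lin_bigsum => i; apply: lin_bigsum => j; apply: lin_scalel.
exact: lin_entry.
Qed.

Lemma lin_sw (U V : lmodType F) (f : U -> vec) (g : vec -> vec -> V) :
  lin f -> lin (fun x => sw (f x) g).
Proof. by move=> lf; apply: lin_swm; apply: lin_comul. Qed.

Lemma lin_swin (U V : lmodType F) h (g : U -> vec -> vec -> V) :
  (forall a b, lin (fun x => g x a b)) -> lin (fun x => sw h (fun a b => g x a b)).
Proof.
move=> lg; apply: lin_bigsum => i; apply: lin_bigsum => j.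
exact: lin_scale.
Qed.

Lemma lin_bil (U V W X : lmodType F) (G : V -> W -> X) (f : U -> V) b :
  bilin G -> lin f -> lin (fun x => G (f x) b).
Proof. by case=> lG _ lf; apply: (lin_comp (lG b)). Qed.

Lemma lin_bir (U V W X : lmodType F) (G : V -> W -> X) (f : U -> W) b :
  bilin G -> lin f -> lin (fun x => G b (f x)).
Proof. by case=> _ lG lf; apply: (lin_comp (lG b)). Qed.

End Sweedler.

(** Syntax-directed linearity. The clauses match explicit abstractions, so the [change] cases first
    eta-expand partially applied operations. *)
Ltac lin_step :=
  match goal with
  | |- bilin _ => split=> ?
  | |- forall _, _ => move=> ?
  | |- @lin ?F ?U ?V (antipH ?H) => change (@lin F U V (fun x => antipH H x))
  | |- @lin ?F ?U ?V (counitH ?H) => change (@lin F U V (fun x => counitH H x))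
  | |- @lin ?F ?U ?V (chev ?c) => change (@lin F U V (fun x => chev c x))
  | |- @lin ?F ?U ?V (repv ?r) => change (@lin F U V (fun x => repv r x))
  | |- @lin ?F ?U ?V (mulH ?H ?y) => change (@lin F U V (fun x => mulH H y x))
  | |- @lin ?F ?U ?V (mulmx ?M) => change (@lin F U V (fun x => mulmx M x))
  | |- lin (fun x => x) => exact: lin_id
  | |- lin (fun x => mulH _ (@?f x) ?y) => apply: lin_mull
  | |- lin (fun x => mulH _ ?y (@?f x)) => apply: lin_mulr
  | |- lin (fun x => antipH _ (@?f x)) => apply: lin_antip
  | |- lin (fun x => counitH _ (@?f x)) => apply: lin_counit
  | |- lin (fun x => chev _ (@?f x)) => apply: lin_chev
  | |- lin (fun x => repv _ (@?f x)) => apply: lin_repv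
  | |- lin (fun x => sw _ (@?f x) ?g) => apply: lin_sw
  | |- lin (fun x => sw _ _ _) => apply: lin_swin
  | |- lin (fun x => ?c *: (@?f x)) => apply: lin_scale
  | |- lin (fun x => (@?f x) *: ?c) => apply: lin_scalel
  | |- lin (fun x => (@?f x) *m ?c) => apply: lin_mulmxl
  | |- lin (fun x => ?c *m (@?f x)) => apply: lin_mulmxr
  | |- lin (fun x => (@?f x) *t ?c) => apply: lin_tensl
  | |- lin (fun x => ?c *t (@?f x)) => apply: lin_tensr
  | |- lin (fun x => (@?f x)^T) => apply: lin_trmx
  | |- lin (fun x => \tr (@?f x)) => apply: lin_mxtrace
  | |- lin (fun x => (@?f x) * ?c) => apply: lin_mulFl
  | |- lin (fun x => ?c * (@?f x)) => apply: lin_mulFr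
  | |- lin (fun x => fun_of_matrix (@?f x) ?i ?j) => apply: lin_entry
  | HG : bilin ?G |- lin (fun x => ?G (@?f x) ?b) => apply: (lin_bil _ HG)
  | HG : bilin ?G |- lin (fun x => ?G ?b (@?f x)) => apply: (lin_bir _ HG)
  | Hf : lin ?g |- lin (fun x => ?g (@?f x)) => apply: (lin_comp Hf)
  | _ => assumption
  end.
Ltac prove_lin := solve [cbv beta; repeat (lin_step; cbv beta)].

(** * Hopf algebra calculus *)

Section HopfCalculus.
Variables (F : fieldType) (n : nat) (H : hopf_data F n).
Hypothesis hH : is_hopf H.
Local Notation vec := 'rV[F]_n.
Local Notation "x ** y" := (mulH H x y) (at level 40, left associativity).
Local Notation S := (antipH H).
Local Notation eps := (counitH H).
Local Notation one := (hunit H).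

Lemma mulHA x y z : x ** (y ** z) = x ** y ** z.
Proof. by case: hH => -[-> _]. Qed.

Lemma mul1H x : one ** x = x.
Proof. by case: hH => -[_ /(_ x)[]]. Qed.

Lemma mulH1 x : x ** one = x.
Proof. by case: hH => -[_ /(_ x)[]]. Qed.

Lemma mulH0 x : x ** 0 = 0.
Proof. by rewrite (@lin0 _ _ _ (fun y => x ** y)) //; prove_lin. Qed.

Lemma mulHZl a x y : (a *: x) ** y = a *: (x ** y).
Proof. by rewrite (@linZ _ _ _ (fun x => x ** y)) //; prove_lin. Qed.

Lemma mulHZr a x y : x ** (a *: y) = a *: (x ** y).
Proof. by rewrite (@linZ _ _ _ (fun y => x ** y)) //; prove_lin. Qed.

Lemma mulHBl x y z : (x - y) ** z = x ** z - y ** z.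
Proof. by rewrite (@linB _ _ _ (fun x => x ** z)) //; prove_lin. Qed.

Lemma mulHBr x y z : z ** (x - y) = z ** x - z ** y.
Proof. by rewrite (@linB _ _ _ (fun x => z ** x)) //; prove_lin. Qed.

Lemma mulHDr x y z : z ** (x + y) = z ** x + z ** y.
Proof. by rewrite (@linD _ _ _ (fun x => z ** x)) //; prove_lin. Qed.

Lemma epsM x y : eps (x ** y) = eps x * eps y.
Proof. by case: hH => _ _ _ [_ [-> _]] _. Qed.

Lemma eps1 : eps one = 1.
Proof. by case: hH => _ _ _ [_ [_ ->]] _. Qed.

Lemma epsZ a x : eps (a *: x) = a * eps x.
Proof.
have le : lin (eps : vec -> F^o) by apply: lin_counit; prove_lin.
exact: (linZ a x le).
Qed.

Lemma comulH_bvec i : comulH H (bvec F i) = hcomul H i.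
Proof. exact: sum_bvec. Qed.

Lemma counitH_bvec i : eps (bvec F i) = hcounit H i.
Proof. by rewrite -[RHS](@sum_bvec F n F^o i (hcounit H)). Qed.

Lemma lin_swl (V : lmodType F) (g : vec -> vec -> V) : lin (fun x => sw H x g).
Proof. prove_lin. Qed.

(** Valid for arbitrary [g]: the iterated sums only evaluate [g] on basis vectors, and
    coassociativity equates the coefficients of each basis triple. *)
Lemma sw_coassoc (V : lmodType F) h (g : vec -> vec -> vec -> V) :
  sw H h (fun a b => sw H a (fun c d => g c d b)) =
  sw H h (fun a b => sw H b (fun c d => g a c d)).
Proof.
rewrite /sw /swm.
transitivity (\sum_c \sum_d \sum_k (\sum_j comulH H h j k * hcomul H j c d)
               *: g (bvec F c) (bvec F d) (bvec F k)).
  transitivity (\sum_j \sum_c \sum_d \sum_k (comulH H h j k * hcomul H j c d)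
               *: g (bvec F c) (bvec F d) (bvec F k)).
    apply: eq_bigr => j _.
    under eq_bigr => k _ do rewrite comulH_bvec scaler_sumr.
    rewrite exchange_big /=; apply: eq_bigr => c _.
    under eq_bigr => k _ do rewrite scaler_sumr.
    rewrite exchange_big /=; apply: eq_bigr => d _.
    by apply: eq_bigr => k _; rewrite scalerA.
  rewrite exchange_big; apply: eq_bigr => c _.
  rewrite exchange_big; apply: eq_bigr => d _.
  rewrite exchange_big; apply: eq_bigr => k _.
  by rewrite scaler_suml.
apply: eq_bigr => a _.
under [RHS]eq_bigr => k _ do rewrite comulH_bvec scaler_sumr.
rewrite [RHS]exchange_big /=; apply: eq_bigr => b _.
under [RHS]eq_bigr => k _ do rewrite scaler_sumr.
rewrite [RHS]exchange_big /=; apply: eq_bigr => c _.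
under [RHS]eq_bigr => k _ do rewrite scalerA.
by rewrite -scaler_suml; case: hH => _ -> _ _ _.
Qed.

Lemma swm_tensor (V : lmodType F) x y (f : vec -> vec -> V) :
  bilin f -> swm (tensor x y) f = f x y.
Proof.
move=> bf; rewrite (@linE _ _ _ (fun x => f x y)); last by prove_lin.
apply: eq_bigr => j _; rewrite (@linE _ _ _ (fun y => f _ y)); last by prove_lin.
rewrite scaler_sumr; apply: eq_bigr => k _.
by rewrite !mxE big_ord1 !mxE scalerA.
Qed.

Lemma sw_mul (V : lmodType F) h g (f : vec -> vec -> V) : bilin f ->
  sw H (h ** g) f = sw H h (fun a b => sw H g (fun c d => f (a ** c) (b ** d))).
Proof.
move=> bf; rewrite /sw.
have -> : comulH H (h ** g) = tmul H (comulH H h) (comulH H g).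
  by case: hH => _ _ _ [[-> _] _] _.
have ls : lin (fun T => swm T f) by apply: lin_swm.
rewrite (lin_sum _ _ _ ls); apply: eq_bigr => j _.
rewrite (lin_sum _ _ _ ls); apply: eq_bigr => k _.
rewrite (lin_sum _ _ _ ls) scaler_sumr; apply: eq_bigr => j' _.
rewrite (lin_sum _ _ _ ls) scaler_sumr; apply: eq_bigr => k' _.
by rewrite (linZ _ _ ls) swm_tensor // scalerA.
Qed.

Lemma sw_one (V : lmodType F) (f : vec -> vec -> V) : bilin f ->
  sw H one f = f one one.
Proof.
move=> bf; rewrite /sw.
have -> : comulH H one = tensor one one by case: hH => _ _ _ [[_ ->] _] _.
exact: swm_tensor.
Qed.

Lemma sw_counitl (V : lmodType F) h (f : vec -> V) : lin f ->
  sw H h (fun a b => eps a *: f b) = f h.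
Proof.
move=> lf; rewrite (linE h lf) /sw /swm exchange_big /=; apply: eq_bigr => k _.
under eq_bigr => j _ do rewrite counitH_bvec scalerA mulrC.
by rewrite -scaler_suml; case: hH => _ _ [-> _] _ _.
Qed.

Lemma sw_counitr (V : lmodType F) h (f : vec -> V) : lin f ->
  sw H h (fun a b => eps b *: f a) = f h.
Proof.
move=> lf; rewrite (linE h lf) /sw /swm /=; apply: eq_bigr => k _.
under eq_bigr => j _ do rewrite counitH_bvec scalerA.
by rewrite -scaler_suml; case: hH => _ _ [_ ->] _ _.
Qed.

Lemma lin_swout (V W : lmodType F) h (g : vec -> vec -> V) (f : V -> W) :
  lin f -> f (sw H h g) = sw H h (fun a b => f (g a b)).
Proof.
move=> lf; rewrite /sw /swm (lin_sum _ _ _ lf); apply: eq_bigr => j _.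
by rewrite (lin_sum _ _ _ lf); apply: eq_bigr => k _; rewrite (linZ _ _ lf).
Qed.

Lemma sw_antipl (V : lmodType F) h (f : vec -> V) : lin f ->
  sw H h (fun a b => f (S a ** b)) = eps h *: f one.
Proof.
move=> lf; rewrite -lin_swout // -linZ //; congr f.
by case: hH => _ _ _ _ /(_ h)[].
Qed.

Lemma sw_antipr (V : lmodType F) h (f : vec -> V) : lin f ->
  sw H h (fun a b => f (a ** S b)) = eps h *: f one.
Proof.
move=> lf; rewrite -lin_swout // -linZ //; congr f.
by case: hH => _ _ _ _ /(_ h)[].
Qed.

Lemma sw_exchange (V : lmodType F) h g (f : vec -> vec -> vec -> vec -> V) :
  sw H h (fun a b => sw H g (fun c d => f a b c d)) =
  sw H g (fun c d => sw H h (fun a b => f a b c d)).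
Proof.
rewrite /sw /swm.
transitivity (\sum_j \sum_k \sum_j' \sum_k' (comulH H h j k * comulH H g j' k')
  *: f (bvec F j) (bvec F k) (bvec F j') (bvec F k')).
  apply: eq_bigr => j _; apply: eq_bigr => k _; rewrite scaler_sumr.
  by apply: eq_bigr => j' _; rewrite scaler_sumr; apply: eq_bigr => k' _; rewrite scalerA.
transitivity (\sum_j \sum_j' \sum_k' \sum_k (comulH H h j k * comulH H g j' k')
  *: f (bvec F j) (bvec F k) (bvec F j') (bvec F k')).
  apply: eq_bigr => j _; rewrite exchange_big; apply: eq_bigr => j' _.
  exact: exchange_big.
rewrite exchange_big; apply: eq_bigr => j' _.
rewrite exchange_big; apply: eq_bigr => k' _.
rewrite scaler_sumr; apply: eq_bigr => j _.
by rewrite scaler_sumr; apply: eq_bigr => k _; rewrite scalerA mulrC.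
Qed.

Lemma antip1 : S one = one.
Proof.
have := @sw_antipl _ one (fun z => z) (@lin_id _ _).
by rewrite sw_one ?mulH1 ?eps1 ?scale1r //; prove_lin.
Qed.

Lemma eps_antip x : eps (S x) = eps x.
Proof.
have /= := @sw_antipl F^o x eps.
have le : lin (eps : vec -> F^o) by apply: lin_counit; prove_lin.
move=> /(_ le); rewrite eps1 [eps x *: _]mulr1 => <-.
under eq_sw => a b do rewrite epsM mulrC.
by rewrite (@sw_counitr F^o x (fun a => eps (S a))) //; prove_lin.
Qed.

(** In the convolution algebra of maps from H (x) H to H, S(xy) is a left inverse and S(y)S(x) a
    right inverse of multiplication. [Z] is the triple product S(x_1 y_1) x_2 y_2 S(y_3) S(x_3);
    contracting its last two or its first two factors gives the two sides. *)
Lemma antipM x y : S (x ** y) = S y ** S x.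
Proof.
pose Z := sw H x (fun x1 x2 => sw H y (fun y1 y2 => S (x1 ** y1) **
   (sw H x2 (fun x3 x4 => sw H y2 (fun y3 y4 => x3 ** y3 ** (S y4 ** S x4)))))).
transitivity Z.
  transitivity (sw H x (fun x1 x2 => eps x2 *: sw H y (fun y1 y2 =>
                  eps y2 *: S (x1 ** y1)))).
    rewrite (@sw_counitr _ x (fun x1 => sw H y (fun y1 y2 => eps y2 *: S (x1 ** y1))));
      last by prove_lin.
    by rewrite (@sw_counitr _ y (fun y1 => S (x ** y1))) //; prove_lin.
  apply: eq_sw => x1 x2; rewrite (@lin_swout _ _ _ _ (fun z => eps x2 *: z)); last by prove_lin.
  apply: eq_sw => y1 y2.
  have -> : sw H x2 (fun x3 x4 => sw H y2 (fun y3 y4 => x3 ** y3 ** (S y4 ** S x4))) =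
            (eps x2 * eps y2) *: one.
    transitivity (sw H x2 (fun x3 x4 => eps y2 *: (x3 ** S x4))).
      apply: eq_sw => x3 x4.
      have := @sw_antipr _ y2 (fun z => x3 ** z ** S x4).
      rewrite mulH1 => <-; last by prove_lin.
      by apply: eq_sw => y3 y4; rewrite !mulHA.
    rewrite (@sw_antipr _ x2 (fun z => eps y2 *: z)); last by prove_lin.
    by rewrite scalerA.
  by rewrite mulHZr mulH1 scalerA.
transitivity (sw H x (fun x1 x2 => sw H y (fun y1 y2 =>
  sw H x1 (fun x3 x4 => sw H y1 (fun y3 y4 => S (x3 ** y3) ** (x4 ** y4)
     ** (S y2 ** S x2)))))).
  transitivity (sw H x (fun x1 x2 => sw H x1 (fun x3 x4 => 
    sw H y (fun y1 y2 => sw H y1 (fun y3 y4 => S (x3 ** y3) ** (x4 ** y4)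
     ** (S y2 ** S x2)))))).
    rewrite (@sw_coassoc _ x (fun x3 x4 x2 => sw H y (fun y1 y2 => sw H y1 (fun y3 y4 =>
      S (x3 ** y3) ** (x4 ** y4) ** (S y2 ** S x2))))).
    apply: eq_sw => x1 x2.
    under [RHS]eq_sw => x3 x4 do rewrite (@sw_coassoc _ y (fun y3 y4 y2 =>
      S (x1 ** y3) ** (x3 ** y4) ** (S y2 ** S x4))).
    rewrite sw_exchange; apply: eq_sw => y1 y2.
    rewrite (@lin_swout _ _ _ _ (fun z => S (x1 ** y1) ** z)); last by prove_lin.
    apply: eq_sw => x3 x4; rewrite (@lin_swout _ _ _ _ (fun z => S (x1 ** y1) ** z)); last by prove_lin.
    by apply: eq_sw => y3 y4; rewrite !mulHA.
  by apply: eq_sw => x1 x2; rewrite sw_exchange.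
transitivity (sw H x (fun x1 x2 => sw H y (fun y1 y2 =>
   (eps x1 * eps y1) *: (S y2 ** S x2)))).
  apply: eq_sw => x1 x2; apply: eq_sw => y1 y2.
  rewrite -(@sw_mul _ x1 y1 (fun a b => S a ** b ** (S y2 ** S x2))); last by prove_lin.
  rewrite (@sw_antipl _ _ (fun z => z ** (S y2 ** S x2))); last by prove_lin.
  by rewrite mul1H epsM.
transitivity (sw H x (fun x1 x2 => eps x1 *: (S y ** S x2))).
  apply: eq_sw => x1 x2.
  have := @sw_counitl _ y (fun y2 => eps x1 *: (S y2 ** S x2)) => <-; last by prove_lin.
  by apply: eq_sw => y1 y2; rewrite scalerA mulrC.
by rewrite (@sw_counitl _ x (fun z => S y ** S z)) //; prove_lin.
Qed.

End HopfCalculus.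

(** * Integrals of normal Hopf subalgebras *)

Section Integrals.
Variables (F : fieldType) (n : nat) (H : hopf_data F n).
Hypothesis hH : is_hopf H.
Local Notation vec := 'rV[F]_n.
Local Notation "x ** y" := (mulH H x y) (at level 40, left associativity).
Local Notation S := (antipH H).
Local Notation eps := (counitH H).
Local Notation one := (hunit H).

(** A projection onto the row space of [A]. It lets sums over the standard basis of H stand in for
    sums over a basis of [A]. *)
Definition proj_on (A : 'M[F]_n) : 'M[F]_n := pinvmx A *m A.

Lemma proj_on_sub (A : 'M[F]_n) m (x : 'M[F]_(m, n)) : (x *m proj_on A <= A)%MS.
Proof. by rewrite mulmxA submxMl. Qed.

Lemma proj_on_id (A : 'M[F]_n) m (x : 'M[F]_(m, n)) :
  (x <= A)%MS -> x *m proj_on A = x.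
Proof. by move=> xA; rewrite mulmxA mulmxKpV. Qed.

Lemma swm_bilinE (V : lmodType F) (f : vec -> vec -> V) x y : bilin f ->
  f x y = \sum_j \sum_k (x 0 j * y 0 k) *: f (bvec F j) (bvec F k).
Proof.
move=> bf; rewrite (@linE _ _ _ (fun x => f x y)); last by prove_lin.
apply: eq_bigr => j _; rewrite (@linE _ _ _ (fun y => f _ y)); last by prove_lin.
by rewrite scaler_sumr; apply: eq_bigr => k _; rewrite scalerA.
Qed.

(** The two inclusions together say that T lies in A (x) A, hence T = P^T T P for P = [proj_on A];
    the two factors P then pass to the arguments of [f]. *)
Lemma swm_proj (V : lmodType F) (A T : 'M[F]_n) (f : vec -> vec -> V) :
  bilin f -> (T <= A)%MS -> (T^T <= A)%MS ->
  swm T f = swm T (fun a b => f (a *m proj_on A) (b *m proj_on A)).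
Proof.
move=> bf TA TA'; set P := proj_on A.
have eT : T = P^T *m T *m P.
  by rewrite -{1}(proj_on_id TA) -{1}[T]trmxK -{1}(proj_on_id TA') trmx_mul trmxK.
rewrite {1}eT /swm.
transitivity (\sum_j \sum_k \sum_p \sum_q (P p j * T p q * P q k)
   *: f (bvec F j) (bvec F k)).
  apply: eq_bigr => j _; apply: eq_bigr => k _; rewrite !mxE scaler_suml.
  rewrite [RHS]exchange_big; apply: eq_bigr => q _.
  rewrite !mxE mulr_suml scaler_suml; apply: eq_bigr => p _.
  by rewrite !mxE.
transitivity (\sum_p \sum_q \sum_j \sum_k (P p j * T p q * P q k)
   *: f (bvec F j) (bvec F k)).
  under eq_bigr => j _ do rewrite exchange_big.
  rewrite exchange_big; apply: eq_bigr => p _.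
  under eq_bigr => j _ do rewrite exchange_big.
  by rewrite exchange_big; apply: eq_bigr => q _.
apply: eq_bigr => p _; apply: eq_bigr => q _.
rewrite [f (_ *m _) _]swm_bilinE // scaler_sumr; apply: eq_bigr => j _.
rewrite scaler_sumr; apply: eq_bigr => k _.
by rewrite scalerA -!rowE !mxE mulrCA mulrA.
Qed.

Lemma hopf_subalg1 : is_hopf_subalg H 1%:M.
Proof. by split=> *; rewrite ?submx1. Qed.

Lemma normal_subalg1 : normal_subalg H 1%:M.
Proof. by move=> *; exact: submx1. Qed.

Lemma trivial_hopf : one <> 0.
Proof.
move=> one0; have /eqP := eps1 hH; rewrite one0 eq_sym.
have -> : eps 0 = 0 by apply: big1 => i _; rewrite mxE mul0r.
by rewrite oner_eq0.
Qed.

(** The form in which normality is used: h x = (ad h_1)(x) h_2 carries an element of K to the left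
    of h without leaving K. *)
Lemma mul_adH h x : h ** x = sw H h (fun a b => adH H a x ** b).
Proof.
pose f c d b := c ** x ** S d ** b.
transitivity (sw H h (fun a b => sw H a (fun c d => f c d b))).
  rewrite (sw_coassoc hH h f).
  transitivity (sw H h (fun a b => eps b *: (a ** x))).
    by rewrite (@sw_counitr _ _ _ hH _ _ (fun a => a ** x)) //; prove_lin.
  apply: eq_sw => a b; rewrite -[a ** x in LHS](mulH1 hH).
  rewrite -(@sw_antipl _ _ _ hH _ _ (fun z => a ** x ** z)); last by prove_lin.
  by apply: eq_sw => c d; rewrite /f !(mulHA hH).
apply: eq_sw => a b; rewrite /f.
have lb : lin (fun z => z ** b) by prove_lin.
exact/esym/(lin_swout H a (fun c d => c ** x ** S d) lb).
Qed.

Lemma eps_adH h x : eps (adH H h x) = eps h * eps x.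
Proof.
have le : lin (eps : vec -> F^o) by prove_lin.
rewrite [eps _](lin_swout H h (fun a b => a ** x ** S b) le).
have e (f g : vec -> vec -> F^o) : (forall a b, f a b = g a b) -> sw H h f = sw H h g.
  exact: eq_sw.
rewrite (e _ (fun a b => eps b *: (eps a * eps x : F^o))); last first.
  by move=> a b; rewrite !(epsM hH) (eps_antip hH) mulrC.
by rewrite (@sw_counitr _ _ _ hH F^o h (fun a => eps a * eps x : F^o)) //; prove_lin.
Qed.

Variables (A : 'M[F]_n) (hA : is_hopf_subalg H A).

Lemma one_in : (one <= A)%MS. Proof. by case: hA. Qed.
Lemma mul_in x y : (x <= A)%MS -> (y <= A)%MS -> (x ** y <= A)%MS.
Proof. by case: hA => _ + _ _; apply. Qed.
Lemma antip_in x : (x <= A)%MS -> (S x <= A)%MS.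
Proof. by case: hA => _ _ _; apply. Qed.

(** Comultiplication sends A into A (x) A, so identities known only on A, such as multiplicativity
    of a representation of A, may be used under the Sweedler sum. *)
Lemma eq_sw_in (V : lmodType F) h (f g : vec -> vec -> V) :
  bilin f -> bilin g -> (h <= A)%MS ->
  (forall a b, (a <= A)%MS -> (b <= A)%MS -> f a b = g a b) ->
  sw H h f = sw H h g.
Proof.
move=> bf bg hhA fg; have [TA TA'] : (comulH H h <= A)%MS /\ ((comulH H h)^T <= A)%MS.
  by case: hA => _ _ + _; apply.
rewrite /sw (swm_proj bf TA TA') (swm_proj bg TA TA').
by apply: eq_swm => a b; apply: fg; apply: proj_on_sub.
Qed.

Lemma sw_in h m (B : 'M[F]_(m, n)) (f : vec -> vec -> vec) : bilin f -> (h <= A)%MS ->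
  (forall a b, (a <= A)%MS -> (b <= A)%MS -> (f a b <= B)%MS) ->
  (sw H h f <= B)%MS.
Proof.
move=> bf hhA fB; have [TA TA'] : (comulH H h <= A)%MS /\ ((comulH H h)^T <= A)%MS.
  by case: hA => _ _ + _; apply.
rewrite /sw (swm_proj bf TA TA'); apply: summx_sub => j _.
by apply: summx_sub => k _; rewrite scalemx_sub // fB // proj_on_sub.
Qed.

(** For a right integral e, S(e_1) (x) e_2 is a Casimir element: x S(e_1) (x) e_2 = x_1 S(e_1 x_2)
    (x) e_2 x_3 = x_1 S(x_2) S(e_1) (x) e_2 x_3 = S(e_1) (x) e_2 x. This is what turns averages into
    intertwiners. *)
Lemma casimirl (V : lmodType F) (G : vec -> vec -> V) e x : bilin G ->
  (forall y, (y <= A)%MS -> e ** y = eps y *: e) -> (x <= A)%MS ->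
  sw H e (fun a b => G (x ** S a) b) = sw H e (fun a b => G (S a) (b ** x)).
Proof.
move=> bG he xA.
transitivity (sw H x (fun x1 x2 => sw H (e ** x2) (fun a b => G (x1 ** S a) b))).
  rewrite [RHS](@eq_sw_in _ _ _ (fun x1 x2 => eps x2 *: sw H e (fun a b => G (x1 ** S a) b)))
    //; [|prove_lin|prove_lin|by move=> a b _ bA; rewrite he // (linZ _ _ (lin_swl H _))].
  by rewrite (@sw_counitr _ _ _ hH _ _ (fun z => sw H e (fun a b => G (z ** S a) b))) //; prove_lin.
transitivity (sw H x (fun x1 x2 => sw H x2 (fun x3 x4 =>
   sw H e (fun a b => G (x1 ** S (a ** x3)) (b ** x4))))).
  apply: eq_sw => x1 x2; rewrite (sw_mul hH); last by prove_lin.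
  by rewrite sw_exchange.
rewrite -(@sw_coassoc _ _ _ hH _ _ (fun x1 x3 x4 =>
   sw H e (fun a b => G (x1 ** S (a ** x3)) (b ** x4)))).
transitivity (sw H x (fun x1 x2 => eps x1 *: sw H e (fun a b => G (S a) (b ** x2)))).
  apply: eq_sw => x1 x2.
  have -> : sw H e (fun a b => G (S a) (b ** x2)) =
            sw H e (fun a b => G (one ** S a) (b ** x2)).
    by apply: eq_sw => a b; rewrite (mul1H hH).
  rewrite -(@sw_antipr _ _ _ hH _ _ (fun z => sw H e (fun a b => G (z ** S a) (b ** x2))));
    last by prove_lin.
  by apply: eq_sw => c d; apply: eq_sw => a b; rewrite (antipM hH) (mulHA hH).
by rewrite (@sw_counitl _ _ _ hH _ _ (fun z => sw H e (fun a b => G (S a) (b ** z)))) //; prove_lin.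
Qed.

(** The mirror image: a left integral makes e_1 (x) S(e_2) a Casimir element. *)
Lemma casimirr (V : lmodType F) (G : vec -> vec -> V) e x : bilin G ->
  (forall y, (y <= A)%MS -> y ** e = eps y *: e) -> (x <= A)%MS ->
  sw H e (fun a b => G (x ** a) (S b)) = sw H e (fun a b => G a (S b ** x)).
Proof.
move=> bG he xA; apply/esym.
transitivity (sw H x (fun x1 x2 => sw H (x1 ** e) (fun a b => G a (S b ** x2)))).
  rewrite [RHS](@eq_sw_in _ _ _ (fun x1 x2 => eps x1 *: sw H e (fun a b => G a (S b ** x2))))
    //; [|prove_lin|prove_lin|by move=> a b aA _; rewrite he // (linZ _ _ (lin_swl H _))].
  by rewrite (@sw_counitl _ _ _ hH _ _ (fun z => sw H e (fun a b => G a (S b ** z)))) //; prove_lin.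
transitivity (sw H x (fun x1 x2 => sw H x1 (fun x3 x4 =>
   sw H e (fun a b => G (x3 ** a) (S (x4 ** b) ** x2))))).
  by apply: eq_sw => x1 x2; rewrite (sw_mul hH) //; prove_lin.
rewrite (@sw_coassoc _ _ _ hH _ _ (fun x3 x4 x2 =>
   sw H e (fun a b => G (x3 ** a) (S (x4 ** b) ** x2)))).
transitivity (sw H x (fun x1 x2 => eps x2 *: sw H e (fun a b => G (x1 ** a) (S b)))).
  apply: eq_sw => x1 x2.
  have -> : sw H e (fun a b => G (x1 ** a) (S b)) =
            sw H e (fun a b => G (x1 ** a) (S b ** one)).
    by apply: eq_sw => a b; rewrite (mulH1 hH).
  rewrite -(@sw_antipl _ _ _ hH _ _ (fun z => sw H e (fun a b => G (x1 ** a) (S b ** z))));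
    last by prove_lin.
  by apply: eq_sw => c d; apply: eq_sw => a b; rewrite (antipM hH) (mulHA hH).
by rewrite (@sw_counitr _ _ _ hH _ _ (fun z => sw H e (fun a b => G (z ** a) (S b)))) //; prove_lin.
Qed.

(** * Existence of a nonzero right integral *)

Definition tr_on (T : vec -> vec) : F^o := \sum_i T (bvec F i *m proj_on A) 0 i.

Lemma eq_tr_on T U : (forall v, (v <= A)%MS -> T v = U v) -> tr_on T = tr_on U.
Proof. by move=> TU; apply: eq_bigr => i _; rewrite TU // proj_on_sub. Qed.

Lemma lin_tr_on (U : lmodType F) (g : U -> vec -> vec) :
  (forall v, lin (fun x => g x v)) -> lin (fun x => tr_on (fun v => g x v)).
Proof. by move=> lg; apply: lin_bigsum => i; apply: lin_entry. Qed.

(** Both maps have to preserve A: only then is [tr_on] of the composites the trace of a product of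
    endomorphisms of A. *)
Lemma tr_onC T U : lin T -> lin U ->
  (forall v, (v <= A)%MS -> (T v <= A)%MS) ->
  (forall v, (v <= A)%MS -> (U v <= A)%MS) ->
  tr_on (fun v => T (U v)) = tr_on (fun v => U (T v)).
Proof.
move=> lT lU TA UA.
have E (X Y : vec -> vec) : lin X -> (forall v, (v <= A)%MS -> (Y v <= A)%MS) ->
    tr_on (fun v => X (Y v)) =
    \sum_i \sum_k Y (bvec F i *m proj_on A) 0 k * X (bvec F k *m proj_on A) 0 i.
  move=> lX YA; apply: eq_bigr => i _; set v := bvec F i *m _.
  have -> : X (Y v) = X (Y v *m proj_on A) by rewrite proj_on_id // YA // proj_on_sub.
  rewrite (@linE _ _ _ (fun w => X (w *m proj_on A))) ?summxE; last first.
    by apply: (lin_comp lX); apply: lin_mulmxl; prove_lin.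
  by apply: eq_bigr => k _; rewrite mxE.
rewrite !E // exchange_big; apply: eq_bigr => k _; apply: eq_bigr => i _.
by rewrite mulrC.
Qed.

(* The invariant of [K (x) K^*] obtained by moving the coevaluation
   [sum x_i (x) x^i] along the isomorphism [a (x) f |-> a_1 (x) S(a_2) f] with
   a free module, evaluated at [y] (left-right mirrored). *)
Definition pre_integral (y : vec) : vec :=
  \sum_i sw H (bvec F i *m proj_on A) (fun a b => (y ** S (S a)) 0 i *: b).

Lemma pre_integral_in y : (pre_integral y <= A)%MS.
Proof.
apply: summx_sub => i _; apply: sw_in; [prove_lin | exact: proj_on_sub|].
by move=> a b _ bA; apply: scalemx_sub.
Qed.

Lemma pre_integral_lin (V : lmodType F) (f : vec -> V) y : lin f ->
  f (pre_integral y) =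
  \sum_i sw H (bvec F i *m proj_on A) (fun a b => (y ** S (S a)) 0 i *: f b).
Proof.
move=> lf; rewrite lin_sum //; apply: eq_bigr => i _; rewrite lin_swout //.
by apply: eq_sw => a b; rewrite linZ.
Qed.

(** Rewrites linear functionals of the candidate integral as traces over A, where cyclicity is
    available. *)
Lemma pre_integral_entry (f : vec -> F^o) y : lin f ->
  f (pre_integral y) = tr_on (fun v => sw H v (fun a b => f b *: (y ** S (S a)))).
Proof.
move=> lf; rewrite (pre_integral_lin _ lf); apply: eq_bigr => i _.
rewrite [RHS](@lin_swout _ _ _ _ F^o _ _ (fun z : vec => z 0 i)); last by prove_lin.
by apply: eq_sw => a b; rewrite mxE; apply: mulrC.
Qed.

(** Coordinate q of the left side is the trace over A of v -> (v_2 x)_q y S^2(v_1). Inserting S(x_1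
    S(x_2)), which contracts to a counit, turns this map into v -> Psi(v x_2) S(x_1). Moving right
    multiplication by S(x_1) around the trace gives Psi(v S(x_1) x_2), which contracts to eps(x)
    Psi(v). *)
Lemma pre_integralP x y : (x <= A)%MS -> (y <= A)%MS ->
  pre_integral y ** x = eps x *: pre_integral y.
Proof.
move=> xA yA; apply/rowP => q; rewrite mxE.
rewrite (@pre_integral_entry (fun z : vec => (z ** x) 0 q)); last by prove_lin.
rewrite (@pre_integral_entry (fun z : vec => z 0 q)); last by prove_lin.
pose Psi v := sw H v (fun a b => b 0 q *: (y ** S (S a))).
have lPsi : lin Psi by apply: lin_swl.
have Psi_in v : (v <= A)%MS -> (Psi v <= A)%MS.
  move=> vA; apply: sw_in => //; first by prove_lin.
  by move=> a b aA bA; rewrite scalemx_sub // mul_in // !antip_in.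
transitivity (tr_on (fun v => sw H x (fun x1 x2 => Psi (v ** x2) ** S x1))).
  apply: eq_tr_on => v vA.
  transitivity (sw H v (fun a b => sw H x (fun x1 x2 => sw H x2 (fun c d =>
      (b ** d) 0 q *: (y ** S (S (a ** c)) ** S x1))))).
    apply: eq_sw => a b.
    rewrite -(@sw_coassoc _ _ _ hH _ _ (fun x1 c d =>
      (b ** d) 0 q *: (y ** S (S (a ** c)) ** S x1))).
    rewrite -(@sw_counitl _ _ _ hH _ _ (fun x => (b ** x) 0 q *: (y ** S (S a))));
      last by prove_lin.
    apply: eq_sw => x1 x2.
    rewrite -{1}[S (S a)](mulH1 hH) -(antip1 hH).
    rewrite -(@sw_antipr _ _ _ hH _ _ (fun z => (b ** x2) 0 q *: (y ** (S (S a) ** S z))));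
      last by prove_lin.
    by apply: eq_sw => c d; rewrite !(antipM hH) !(mulHA hH).
  rewrite sw_exchange; apply: eq_sw => x1 x2.
  rewrite /Psi (sw_mul hH); last by prove_lin.
  rewrite (@lin_swout _ _ _ _ _ _ _ (fun z => z ** S x1)); last by prove_lin.
  apply: eq_sw => a b.
  rewrite (@lin_swout _ _ _ _ _ _ _ (fun z => z ** S x1)); last by prove_lin.
  by apply: eq_sw => c d; rewrite mulHZl.
transitivity (sw H x (fun x1 x2 => tr_on (fun v => Psi (v ** x2) ** S x1))).
  have le i : lin (fun z : vec => z 0 i : F^o) by prove_lin.
  rewrite /tr_on; under eq_bigr => i _ do rewrite (lin_swout H x _ (le i)).
  rewrite /sw /swm /=.
  rewrite exchange_big; apply: eq_bigr => j _.
  rewrite exchange_big; apply: eq_bigr => k _.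
  by rewrite scaler_sumr.
have lP (x1 : vec) : lin (fun v => Psi v ** x1) by apply: lin_mull.
have lP' (x1 : vec) : lin (fun v => Psi (v ** x1)) by apply: (lin_comp lPsi); prove_lin.
transitivity (sw H x (fun x1 x2 => tr_on (fun v => Psi (v ** (S x1 ** x2))))).
  apply: (@eq_sw_in F^o) => //.
  - split=> ?; apply: lin_tr_on => v; first by prove_lin.
    by apply: lin_mull; apply: (lin_comp lPsi); prove_lin.
  - by split=> ?; apply: lin_tr_on => v; apply: (lin_comp lPsi); prove_lin.
  move=> x1 x2 x1A x2A.
  rewrite (@tr_onC (fun w => w ** S x1) (fun v => Psi (v ** x2))) //.
  - by apply: eq_tr_on => v _; rewrite (mulHA hH).
  - prove_lin.
  - by move=> v vA; rewrite mul_in // antip_in.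
  - by move=> v vA; rewrite Psi_in // mul_in.
rewrite (@sw_antipl _ _ _ hH F^o _ (fun z => tr_on (fun v => Psi (v ** z)))); last first.
  by apply: lin_tr_on => v; apply: (lin_comp lPsi); prove_lin.
by apply: (congr1 (fun z => eps x * z)); apply: eq_tr_on => v _; rewrite (mulH1 hH).
Qed.

(** The unit can be recovered from the values of [pre_integral]. With v running over the projected
    basis vectors P(e_i), 1 is the sum of 1_i v, and since S(S(v_1) v_2) contracts to a counit this
    is the sum of (S(v_2) S^2(v_1))_i v_3. If all the values vanished, so would 1, against eps(1) =
    1. *)
Lemma pre_integral_inj : (forall y, (y <= A)%MS -> pre_integral y = 0) -> False.
Proof.
move=> pre0; case: trivial_hopf.
transitivity (\sum_i one 0 i *: (bvec F i *m proj_on A)).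
  rewrite -(@linE _ _ _ (fun z => z *m proj_on A)); first by rewrite proj_on_id // one_in.
  by apply: lin_mulmxl; prove_lin.
transitivity (\sum_i sw H (bvec F i *m proj_on A) (fun u c =>
   sw H u (fun a b => (one ** S b ** S (S a)) 0 i *: c))).
  apply: eq_bigr => i _.
  rewrite -(@sw_counitl _ _ _ hH _ _ (fun c => one 0 i *: c)); last by prove_lin.
  apply: eq_sw => u c.
  have := @sw_antipl _ _ _ hH _ u (fun z => (one ** S z) 0 i *: c).
  rewrite (antip1 hH) (mulH1 hH) => <-; last by prove_lin.
  by apply: eq_sw => a b; rewrite (antipM hH) (mulHA hH).
transitivity (\sum_i sw H (bvec F i *m proj_on A) (fun a u =>
   sw H u (fun b c => (one ** S b ** S (S a)) 0 i *: c))).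
  by apply: eq_bigr => i _; rewrite (sw_coassoc hH _ (fun a b c =>
    (one ** S b ** S (S a)) 0 i *: c)).
pose P := proj_on A.
transitivity (\sum_i sw H (bvec F i *m P) (fun a u =>
   sw H u (fun b c => (S (b *m P) ** S (S a)) 0 i *: c))).
  apply: eq_bigr => i _; apply: eq_sw_in; [prove_lin|prove_lin|exact: proj_on_sub|].
  move=> a u _ uA; apply: eq_sw_in => //; [prove_lin|prove_lin|].
  by move=> b c bA _; rewrite (mul1H hH) proj_on_id.
(* Expanding u_1 (x) u_2 in the basis freezes its first leg at e_j. For fixed j and k, the sum over
   i is then a linear image of [pre_integral (S (bvec F j *m P))]. *)
transitivity (\sum_j \sum_k \sum_i sw H (bvec F i *m P) (fun a u =>
   (S (bvec F j *m P) ** S (S a)) 0 i *: (comulH H u j k *: bvec F k))).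
  under [RHS]eq_bigr => j _ do rewrite exchange_big /=.
  rewrite [RHS]exchange_big /=; apply: eq_bigr => i _.
  rewrite {1}/sw {1}/swm.
  under [RHS]eq_bigr => j _ do rewrite exchange_big /=.
  rewrite [RHS]exchange_big /=; apply: eq_bigr => p _.
  under [RHS]eq_bigr => j _.
    under eq_bigr => k _ do rewrite /sw /swm.
    rewrite exchange_big /=.
    over.
  rewrite /= [RHS]exchange_big /=; apply: eq_bigr => q _.
  rewrite {1}/sw {1}/swm scaler_sumr; apply: eq_bigr => j _.
  rewrite scaler_sumr; apply: eq_bigr => k _.
  by rewrite [in RHS]scalerA [in RHS](mulrC _ (comulH _ _ _ _)) -scalerA.
apply: big1 => j _; apply: big1 => k _.
rewrite -(@pre_integral_lin _ (fun u => comulH H u j k *: bvec F k)).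
  rewrite pre0 ?antip_in ?proj_on_sub //.
  by rewrite /comulH summxE big1 ?scale0r // => l _; rewrite !mxE mul0r.
by apply: lin_scalel; apply: lin_entry; apply: lin_comul; prove_lin.
Qed.

Lemma right_integral : exists t : vec, [/\ (t <= A)%MS, t <> 0 &
  forall x, (x <= A)%MS -> t ** x = eps x *: t].
Proof.
apply: NNPP => no_t; apply: pre_integral_inj => y yA.
apply: NNPP => ty_neq0; apply: no_t; exists (pre_integral y); split => //.
  exact: pre_integral_in.
by move=> x xA; apply: pre_integralP.
Qed.

(** * Normalized central integrals *)

Section Semisimple.
Hypothesis hss : semisimple H.

(** Let V be a complement of the left ideal U = H y and write 1 = g y + w with w in V. Then y = y g
    y + y w = y w lies in both U and V. *)
Lemma semiprime y : (forall h, y ** h ** y = 0) -> y = 0.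
Proof.
move=> yhy.
pose U := \matrix_i (bvec F i ** y).
have UE h : h *m U = h ** y.
  rewrite (@linE _ _ _ (fun h => h ** y)); last by prove_lin.
  by rewrite mulmx_sum_row; apply: eq_bigr => i _; rewrite rowK.
have lU : left_ideal H U.
  by move=> h u /submxP[g ->]; rewrite UE (mulHA hH) -UE submxMl.
have [V [lV [UV1 UV0]]] := hss lU.
have /sub_addsmxP[[g w] /= e1] : (one <= U + V)%MS by rewrite (eqmxP UV1) submx1.
have yw : y = y ** (w *m V).
  by rewrite -{1}(mulH1 hH y) e1 mulHDr UE (mulHA hH) yhy add0r.
have : (y <= U :&: V)%MS.
  rewrite sub_capmx -{1}(mul1H hH y) -UE submxMl yw.
  by apply: lV; rewrite submxMl.
by rewrite (eqP UV0) submx0 => /eqP.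
Qed.

Lemma normal_integral : normal_subalg H A -> exists e : vec,
  [/\ (e <= A)%MS, eps e = 1, (forall h, e ** h = h ** e) &
      forall x, (x <= A)%MS -> e ** x = eps x *: e].
Proof.
move=> nA; have [t [tA t0 tx]] := right_integral.
(* Normality enters here: t h x = t (ad h_1)(x) h_2, the adjoint action stays in A, and eps((ad
   h_1)(x)) = eps(h_1) eps(x). *)
have thx h x : (x <= A)%MS -> t ** h ** x = eps x *: (t ** h).
  move=> xA; rewrite -(mulHA hH) (mul_adH h).
  rewrite (@lin_swout _ _ _ _ _ _ _ (fun z => t ** z)); last by prove_lin.
  transitivity (sw H h (fun a b => eps a *: (eps x *: (t ** b)))).
    apply: eq_sw => a b; rewrite (mulHA hH) tx ?nA // eps_adH.
    by rewrite mulHZl scalerA.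
  by rewrite (@sw_counitl _ _ _ hH _ _ (fun b => eps x *: (t ** b))) //; prove_lin.
(* Otherwise [thx] with x = t gives t h t = 0 for all h, and semiprimeness kills t. *)
have et0 : eps t != 0.
  apply/eqP => et0; apply: t0; apply: semiprime => h.
  by rewrite thx // et0 scale0r.
pose e := (eps t)^-1 *: t.
have eA : (e <= A)%MS by rewrite scalemx_sub.
have ee : eps e = 1 by rewrite epsZ mulVf.
have ehx h x : (x <= A)%MS -> e ** h ** x = eps x *: (e ** h).
  by move=> xA; rewrite /e !mulHZl thx // scalerA mulrC -scalerA.
have ehe h : e ** h ** e = e ** h by rewrite ehx // ee scale1r.
have eI : e ** e = e by have := ehe one; rewrite !(mulH1 hH).
exists e; split=> // [h|x xA]; last first.
  by rewrite /e mulHZl tx // !scalerA mulrC.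
(* Since e h = e h e, it remains to kill y = e h e - h e. It satisfies e y = 0 and y = y e, so y g y
   = y (e g) y = y (e g e) y = 0 for every g. *)
rewrite -ehe; apply/eqP; rewrite -subr_eq0; apply/eqP.
have ey : e ** (e ** h ** e - h ** e) = 0.
  by rewrite mulHBr !(mulHA hH) eI subrr.
have ye : e ** h ** e - h ** e = (e ** h ** e - h ** e) ** e.
  by rewrite mulHBl -(mulHA hH (e ** h)) -(mulHA hH h) eI.
apply: semiprime => g; set y := e ** h ** e - h ** e in ey ye *.
rewrite [in y ** g]ye -(mulHA hH y) -ehe -!(mulHA hH) ey.
by rewrite !mulH0.
Qed.

End Semisimple.
End Integrals.

(** * Representations and averaging *)

Section MatrixFacts.
Variable F : fieldType.

Lemma mxtrace_tens m n (A : 'M[F]_m) (B : 'M[F]_n) : \tr (A *t B) = \tr A * \tr B.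
Proof. by rewrite /mxtrace mulr_sum; apply: eq_bigr => k _; rewrite mxE. Qed.

Lemma tensmx11 m n : (1%:M : 'M[F]_m) *t (1%:M : 'M[F]_n) = 1%:M.
Proof.
apply/matrixP => i j; case: (mxtens_indexP i) => i1 i2; case: (mxtens_indexP j) => j1 j2.
rewrite tensmxE !mxE (can_eq (@mxtens_indexK _ _)) xpair_eqE.
by case: (i1 == j1); rewrite ?mul1r ?mul0r.
Qed.

(** With E = C R for a full column rank C and a full row rank R, idempotence reads C (R C) R = C R,
    and both outer factors cancel. *)
Lemma idem_base m (E : 'M[F]_m) : E *m E = E -> row_base E *m col_base E = 1%:M.
Proof.
move=> EE; have: col_base E *m (row_base E *m col_base E) *m row_base E =
                 col_base E *m 1%:M *m row_base E.
  by rewrite mulmx1 mulmxA -(mulmxA (_ *m _)) mulmx_base.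
move/(row_free_inj (row_base_free E)); apply: (row_full_inj (col_base_full E)).
Qed.

Lemma mxtrace_idem m (E : 'M[F]_m) : E *m E = E -> \tr E = (\rank E)%:R.
Proof. by move/idem_base => e; rewrite -{1}(mulmx_base E) mxtrace_mulC e mxtrace1. Qed.

Lemma row_base0 d d' (E : 'M[F]_d) (X : 'M[F]_(d, d')) : row_base E *m X = 0 -> E *m X = 0.
Proof. by move=> e; rewrite -{1}(mulmx_base E) -mulmxA e mulmx0. Qed.

Lemma col_base0 d d' (E : 'M[F]_d) (X : 'M[F]_(d', d)) : X *m col_base E = 0 -> X *m E = 0.
Proof. by move=> e; rewrite -{1}(mulmx_base E) mulmxA e mul0mx. Qed.

Lemma row_baseE d (E : 'M[F]_d) : E *m E = E -> row_base E *m E = row_base E.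
Proof.
move=> EE; have := congr1 (mulmx (row_base E)) (mulmx_base E).
by rewrite mulmxA (idem_base EE) mul1mx.
Qed.

Lemma col_baseE d (E : 'M[F]_d) : E *m E = E -> E *m col_base E = col_base E.
Proof.
move=> EE; have := congr1 (mulmx^~ (col_base E)) (mulmx_base E).
by rewrite -mulmxA (idem_base EE) mulmx1.
Qed.

End MatrixFacts.

Section Representations.
Variables (F : fieldType) (n : nat) (H : hopf_data F n).
Hypothesis hH : is_hopf H.
Local Notation vec := 'rV[F]_n.
Local Notation "x ** y" := (mulH H x y) (at level 40, left associativity).
Local Notation S := (antipH H).
Local Notation eps := (counitH H).
Local Notation one := (hunit H).

Lemma sw_sum (V : lmodType F) h I (r : seq I) (P : pred I) (g : I -> vec -> vec -> V) :
  sw H h (fun a b => \sum_(i <- r | P i) g i a b) =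
  \sum_(i <- r | P i) sw H h (g i).
Proof.
rewrite /sw /swm [RHS]exchange_big; apply: eq_bigr => j _.
rewrite [RHS]exchange_big; apply: eq_bigr => k _.
by rewrite scaler_sumr.
Qed.

Lemma sw_inner (V : lmodType F) h (f : vec -> vec -> vec -> V) :
  sw H h (fun u c => sw H u (fun p b => f c p b)) =
  \sum_j \sum_k sw H h (fun u c => comulH H u j k *: f c (bvec F j) (bvec F k)).
Proof.
transitivity (\sum_j sw H h (fun u c =>
  \sum_k comulH H u j k *: f c (bvec F j) (bvec F k))).
  by rewrite -(sw_sum _ _ _ (fun j u c => \sum_k comulH H u j k *: f c (bvec F j) (bvec F k))).
apply: eq_bigr => j _.
by rewrite (sw_sum _ _ _ (fun k u c => comulH H u j k *: f c (bvec F j) (bvec F k))).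
Qed.

(** Otherwise some nonzero functional [al] kills the image of S. The Casimir property gives
    al(S(L_2) x) L_1 = al(S(L_2)) x L_1 = 0 for all x. Writing al(z) L as al(S(L_3) S^2(L_2) z) L_1
    and expanding in the second leg shows al(z) L = 0, although L is nonzero and z can be chosen
    with al(z) nonzero. *)
Lemma antip_surj (L : vec) : L != 0 -> (forall x, x ** L = eps x *: L) ->
  row_full (hanti H).
Proof.
move=> L0 hL; apply: contraNT L0 => nfull.
have {nfull} : cokermx (hanti H) != 0.
  rewrite -mxrank_eq0 mxrank_coker subn_eq0 -ltnNge ltn_neqAle.
  by rewrite rank_leq_col andbT.
move=> /matrix0Pn[i [j aij]].
pose al (x : vec) : F := (x *m cokermx (hanti H)) 0 j.
have lal : lin (al : vec -> F^o) by rewrite /al; prove_lin.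
have alS x : al (S x) = 0 by rewrite /al /antipH -mulmxA mulmx_coker mulmx0 mxE.
have vanish x : sw H L (fun p q => al (S q ** x) *: p) = 0.
  have := @casimirr _ _ _ hH _ (hopf_subalg1 H) _ (fun p q => al q *: p) L x.
  move=> <-; [|prove_lin|by move=> *; exact: hL|exact: submx1].
  rewrite /sw /swm big1 // => p _; rewrite big1 // => q _.
  by rewrite alS scale0r scaler0.
have : al (bvec F i) *: L = 0.
  set z := bvec F i.
  transitivity (sw H L (fun p r => sw H r (fun b c => al (S c ** (S (S b) ** z)) *: p))).
    rewrite -(@sw_counitr _ _ _ hH _ _ (fun p => al z *: p)); last by prove_lin.
    apply: eq_sw => p r.
    have := @sw_antipl _ _ _ hH _ r (fun w => al (S w ** z) *: p).
    rewrite (antip1 hH) (mul1H hH) => <-; last by prove_lin.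
    by apply: eq_sw => b c; rewrite (antipM hH) (mulHA hH).
  rewrite -(@sw_coassoc _ _ _ hH _ _ (fun p b c => al (S c ** (S (S b) ** z)) *: p)).
  rewrite (@sw_inner _ _ (fun c p b => al (S c ** (S (S b) ** z)) *: p)).
  apply: big1 => p _; apply: big1 => q _.
  transitivity (comulH H (sw H L (fun u c => al (S c ** (S (S (bvec F q)) ** z)) *: u)) p q
                *: bvec F p).
    have lg : lin (fun u => comulH H u p q *: bvec F p).
      by apply: lin_scalel; apply: lin_entry; apply: lin_comul; prove_lin.
    rewrite (lin_swout H L _ lg); apply: eq_sw => u c.
    by rewrite [RHS](linZ _ _ lg) !scalerA mulrC.
  rewrite vanish.
  by rewrite /comulH summxE big1 ?scale0r // => l _; rewrite !mxE mul0r.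
move/eqP; rewrite scaler_eq0 => /orP[|//].
by rewrite /al -rowE mxE (negbTE aij).
Qed.

Lemma repv_bvec d (rho : 'I_n -> 'M[F]_d) i : repv rho (bvec F i) = rho i.
Proof. exact: sum_bvec. Qed.

Lemma repv_lin d (f : vec -> 'M[F]_d) h :
  lin f -> repv (fun i => f (bvec F i)) h = f h.
Proof. by move=> lf; rewrite [RHS]linE. Qed.

Lemma chev_charv d (rho : 'I_n -> 'M[F]_d) h : chev (charv rho) h = \tr (repv rho h).
Proof.
rewrite /repv /chev linear_sum; apply: eq_bigr => i _.
by rewrite mxE linearZ.
Qed.

Lemma chev_dmul (chi mu : vec) h :
  chev (dmul H chi mu) h = sw H h (fun a b => chev chi a * chev mu b : F^o).
Proof.
rewrite (@linE _ _ F^o (fun h => sw H h _)); last by prove_lin.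
apply: eq_bigr => i _; congr (_ * _); rewrite mxE /sw /swm comulH_bvec.
apply: eq_bigr => j _; apply: eq_bigr => k _.
have e (c : vec) l : chev c (bvec F l) = c 0 l by exact: (sum_bvec (V := F^o)).
by rewrite !e -mulrA.
Qed.

Lemma chev_dualch (chi : vec) h : chev (dualch H chi) h = chev chi (S h).
Proof.
rewrite [RHS](@linE _ _ F^o (fun h => chev chi (S h))); last by prove_lin.
by apply: eq_bigr => i _; congr (_ * _); rewrite mxE.
Qed.

Lemma chev_epsv h : chev (epsv H) h = eps h.
Proof. by apply: eq_bigr => i _; rewrite mxE. Qed.

Lemma chev_inj (chi mu : vec) : (forall h, chev chi h = chev mu h) -> chi = mu.
Proof.
have e (c : vec) l : chev c (bvec F l) = c 0 l by exact: (sum_bvec (V := F^o)).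
by move=> E; apply/rowP => i; rewrite -!e E.
Qed.

(** * Tensor products, duals, sums and compressions of representations *)

Definition tensor_rep d d' (rho : 'I_n -> 'M[F]_d) (sigma : 'I_n -> 'M[F]_d') i :=
  sw H (bvec F i) (fun a b => repv rho a *t repv sigma b).

Definition dual_rep d (rho : 'I_n -> 'M[F]_d) i := (repv rho (S (bvec F i)))^T.

Definition sum_rep d d' (rho : 'I_n -> 'M[F]_d) (sigma : 'I_n -> 'M[F]_d') i :
  'M[F]_(d + d') := block_mx (rho i) 0 0 (sigma i).

(** The compression of [rho] to the row space of an idempotent E. If that space is stable this is
    the subrepresentation, and the compression to [1%:M - E] is the quotient. *)
Definition comp_rep d (rho : 'I_n -> 'M[F]_d) (E : 'M[F]_d) i : 'M[F]_(\rank E) :=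
  row_base E *m rho i *m col_base E.

Section Constructions.
Variables (d d' : nat) (rho : 'I_n -> 'M[F]_d) (sigma : 'I_n -> 'M[F]_d').

Lemma repv_tensor h :
  repv (tensor_rep rho sigma) h = sw H h (fun a b => repv rho a *t repv sigma b).
Proof. by rewrite (@repv_lin _ (fun h => sw H h _)) //; prove_lin. Qed.

Lemma repv_dual h : repv (dual_rep rho) h = (repv rho (S h))^T.
Proof. by rewrite (@repv_lin _ (fun h => (repv rho (S h))^T)) //; prove_lin. Qed.

Lemma repv_sum h : repv (sum_rep rho sigma) h = block_mx (repv rho h) 0 0 (repv sigma h).
Proof.
rewrite -(@repv_lin _ (fun h => block_mx (repv rho h) 0 0 (repv sigma h))).
  by apply: eq_bigr => i _; rewrite !repv_bvec.
move=> a x y; rewrite !(@lin_repv _ _ _ _ _ _ (@lin_id _ _)).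
by rewrite scale_block_mx add_block_mx !scaler0 !addr0.
Qed.

Lemma repv_comp (E : 'M[F]_d) h :
  repv (comp_rep rho E) h = row_base E *m repv rho h *m col_base E.
Proof.
rewrite -(@repv_lin _ (fun h => row_base E *m repv rho h *m col_base E)); last by prove_lin.
by apply: eq_bigr => i _; rewrite repv_bvec.
Qed.

Lemma charv_tensor : charv (tensor_rep rho sigma) = dmul H (charv rho) (charv sigma).
Proof.
apply: chev_inj => h; rewrite chev_charv repv_tensor chev_dmul.
rewrite (@lin_swout _ _ _ _ F^o _ _ (fun z => \tr z)); last by prove_lin.
by apply: (@eq_sw _ _ _ F^o) => a b; rewrite mxtrace_tens !chev_charv.
Qed.

Lemma charv_dual : charv (dual_rep rho) = dualch H (charv rho).
Proof.
by apply: chev_inj => h; rewrite chev_charv repv_dual chev_dualch chev_charv mxtrace_tr.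
Qed.

Lemma charv_sum : charv (sum_rep rho sigma) = charv rho + charv sigma.
Proof. by apply/rowP => i; rewrite !mxE mxtrace_block. Qed.

Lemma charv_comp (E : 'M[F]_d) :
  E *m E = E -> charv (comp_rep rho E) = \row_i \tr (E *m rho i).
Proof.
move=> EE; apply/rowP => i; rewrite !mxE.
by rewrite /comp_rep -mulmxA mxtrace_mulC -mulmxA mulmx_base mxtrace_mulC.
Qed.

End Constructions.

Lemma charv_split d (rho : 'I_n -> 'M[F]_d) (E : 'M[F]_d) : E *m E = E ->
  charv rho = charv (comp_rep rho E) + charv (comp_rep rho (1%:M - E)).
Proof.
move=> EE; rewrite !charv_comp //; last first.
  by rewrite mulmxBl mul1mx mulmxBr mulmx1 EE subrr subr0.
by apply/rowP => i; rewrite !mxE -mxtraceD -mulmxDl addrC subrK mul1mx.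
Qed.

Section OnSubalgebra.
Variables (A : 'M[F]_n) (hA : is_hopf_subalg H A).

Lemma tensor_rep_on d d' (rho : 'I_n -> 'M[F]_d) (sigma : 'I_n -> 'M[F]_d') :
  is_rep_on H A rho -> is_rep_on H A sigma -> is_rep_on H A (tensor_rep rho sigma).
Proof.
move=> [r1 rM] [s1 sM]; split=> [|h g hhA gA].
  by rewrite repv_tensor (sw_one hH) ?r1 ?s1 ?tensmx11 //; prove_lin.
rewrite !repv_tensor (sw_mul hH); last by prove_lin.
rewrite (@lin_swout _ _ _ _ _ _ _ (fun z => z *m _)); last by prove_lin.
apply: (eq_sw_in hA) => //; [prove_lin|prove_lin|move=> a b aA bA].
rewrite (@lin_swout _ _ _ _ _ _ _ (fun z => _ *m z)); last by prove_lin.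
apply: (eq_sw_in hA) => //; [prove_lin|prove_lin|move=> c e cA eA].
by rewrite tensmx_mul rM // sM.
Qed.

Lemma dual_rep_on d (rho : 'I_n -> 'M[F]_d) :
  is_rep_on H A rho -> is_rep_on H A (dual_rep rho).
Proof.
move=> [r1 rM]; split=> [|h g hhA gA]; rewrite !repv_dual.
  by rewrite (antip1 hH) r1 trmx1.
by rewrite (antipM hH) rM ?(antip_in hA) // trmx_mul.
Qed.

Lemma sum_rep_on d d' (rho : 'I_n -> 'M[F]_d) (sigma : 'I_n -> 'M[F]_d') :
  is_rep_on H A rho -> is_rep_on H A sigma -> is_rep_on H A (sum_rep rho sigma).
Proof.
move=> [r1 rM] [s1 sM]; split=> [|h g hhA gA]; rewrite !repv_sum.
  by rewrite r1 s1 -scalar_mx_block.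
by rewrite mulmx_block !(mul0mx, mulmx0, addr0, add0r) rM // sM.
Qed.

(** The condition on E is weaker than stability of its row space, so that it covers quotients as
    well as subrepresentations. *)
Lemma comp_rep_on d (rho : 'I_n -> 'M[F]_d) (E : 'M[F]_d) :
  is_rep_on H A rho -> E *m E = E ->
  (forall h g, (h <= A)%MS -> (g <= A)%MS ->
     E *m repv rho h *m E *m repv rho g *m E = E *m repv rho h *m repv rho g *m E) ->
  is_rep_on H A (comp_rep rho E).
Proof.
move=> [r1 rM] EE hE; have b1 := idem_base EE.
have rE := row_baseE EE; have cE := col_baseE EE.
split=> [|h g hhA gA]; rewrite !repv_comp.
  by rewrite r1 mulmx1.
move: (row_base E) (col_base E) (mulmx_base E) b1 rE cE => R C CR b1 rE cE.
have -> : R *m repv rho h *m C *m (R *m repv rho g *m C) =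
          R *m (E *m repv rho h *m E *m repv rho g *m E) *m C.
  by rewrite -{1}rE -{2}cE !mulmxA -(mulmxA _ C R) CR.
by rewrite hE // rM // -{1}rE -{1}cE !mulmxA.
Qed.

(** * Averaging over an integral *)

Section Integral.
Variables (e : vec) (eA : (e <= A)%MS) (e1 : eps e = 1).
Hypotheses (er : forall x, (x <= A)%MS -> e ** x = eps x *: e)
           (el : forall x, (x <= A)%MS -> x ** e = eps x *: e).

(** The integral is idempotent, so it acts on the tensor product of the dual of [rho] with [sigma]
    as an idempotent matrix, whose trace is its rank. *)
Lemma mult_nat d d' (rho : 'I_n -> 'M[F]_d) (sigma : 'I_n -> 'M[F]_d') :
  is_rep_on H A rho -> is_rep_on H A sigma ->
  exists m : nat, chev (dmul H (dualch H (charv rho)) (charv sigma)) e = m%:R.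
Proof.
move=> hr hs; rewrite -charv_dual -charv_tensor chev_charv.
have [_ tM] := tensor_rep_on (dual_rep_on hr) hs.
eexists; apply: mxtrace_idem.
by rewrite -tM // er // e1 scale1r.
Qed.

Definition averl d d' (rho : 'I_n -> 'M[F]_d) (sigma : 'I_n -> 'M[F]_d') (X : 'M_(d, d')) :=
  sw H e (fun a b => repv rho (S a) *m X *m repv sigma b).

Definition averr d d' (rho : 'I_n -> 'M[F]_d) (sigma : 'I_n -> 'M[F]_d') (X : 'M_(d, d')) :=
  sw H e (fun a b => repv rho a *m X *m repv sigma (S b)).

Lemma averl_inter d d' (rho : 'I_n -> 'M[F]_d) (sigma : 'I_n -> 'M[F]_d') X x :
  is_rep_on H A rho -> is_rep_on H A sigma -> (x <= A)%MS ->
  repv rho x *m averl rho sigma X = averl rho sigma X *m repv sigma x.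
Proof.
move=> [_ rM] [_ sM] xA; rewrite /averl.
rewrite (@lin_swout _ _ _ _ _ _ _ (fun z => _ *m z)); last by prove_lin.
rewrite (@lin_swout _ _ _ _ _ _ _ (fun z => z *m _)); last by prove_lin.
pose G a b := repv rho a *m X *m repv sigma b.
transitivity (sw H e (fun a b => G (x ** S a) b)).
  apply: (eq_sw_in hA) => //; rewrite /G; [prove_lin|prove_lin|move=> a b aA bA].
  by rewrite rM ?(antip_in hA) // !mulmxA.
rewrite (@casimirl _ _ _ hH _ hA _ G) //; last by rewrite /G; prove_lin.
apply: (eq_sw_in hA) => //; rewrite /G; [prove_lin|prove_lin|move=> a b aA bA].
by rewrite sM // !mulmxA.
Qed.

Lemma averr_inter d d' (rho : 'I_n -> 'M[F]_d) (sigma : 'I_n -> 'M[F]_d') X x :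
  is_rep_on H A rho -> is_rep_on H A sigma -> (x <= A)%MS ->
  repv rho x *m averr rho sigma X = averr rho sigma X *m repv sigma x.
Proof.
move=> [_ rM] [_ sM] xA; rewrite /averr.
rewrite (@lin_swout _ _ _ _ _ _ _ (fun z => _ *m z)); last by prove_lin.
rewrite (@lin_swout _ _ _ _ _ _ _ (fun z => z *m _)); last by prove_lin.
pose G a b := repv rho a *m X *m repv sigma b.
transitivity (sw H e (fun a b => G (x ** a) (S b))).
  apply: (eq_sw_in hA) => //; rewrite /G; [prove_lin|prove_lin|move=> a b aA bA].
  by rewrite rM // !mulmxA.
rewrite (@casimirr _ _ _ hH _ hA _ G) //; last by rewrite /G; prove_lin.
apply: (eq_sw_in hA) => //; rewrite /G; [prove_lin|prove_lin|move=> a b aA bA].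
by rewrite sM ?(antip_in hA) // !mulmxA.
Qed.

(** Both sides are the trace of the operator X -> M X N on matrices. Applied under the Sweedler sum,
    it makes the pairing of two characters at e the trace of the averaging operator. *)
Lemma mxtrace_delta d d' (M : 'M[F]_d) (N : 'M[F]_d') :
  \tr M * \tr N = \sum_p \sum_q (M *m delta_mx p q *m N) p q.
Proof.
rewrite mulr_suml; apply: eq_bigr => p _; rewrite mulr_sumr; apply: eq_bigr => q _.
rewrite mxE (bigD1 q) //= big1 ?addr0 => [|j jq].
  rewrite mxE (bigD1 p) //= big1 ?addr0 => [|i ip].
    by rewrite mxE !eqxx mulr1.
  by rewrite mxE (negbTE ip) mulr0.
rewrite mxE big1 ?mul0r // => i _.
by rewrite mxE (negbTE jq) andbF mulr0.
Qed.

Lemma pairingl_aver d d' (rho : 'I_n -> 'M[F]_d) (sigma : 'I_n -> 'M[F]_d') :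
  chev (dmul H (dualch H (charv rho)) (charv sigma)) e =
  \sum_p \sum_q averl rho sigma (delta_mx p q) p q.
Proof.
rewrite chev_dmul.
transitivity (\sum_p \sum_q sw H e (fun a b =>
   (repv rho (S a) *m delta_mx p q *m repv sigma b) p q : F^o)).
  transitivity (\sum_p sw H e (fun a b => \sum_q
     (repv rho (S a) *m delta_mx p q *m repv sigma (b)) p q : F^o)).
    rewrite -(@sw_sum F^o _ _ _ _ (fun p a b => \sum_q
      (repv rho (S a) *m delta_mx p q *m repv sigma (b)) p q)).
    apply: (@eq_sw _ _ _ F^o) => a b.
    by rewrite chev_dualch !chev_charv mxtrace_delta.
  apply: eq_bigr => p _.
  by rewrite (@sw_sum F^o _ _ _ _ (fun q a b =>
      (repv rho (S a) *m delta_mx p q *m repv sigma (b)) p q)).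
apply: eq_bigr => p _; apply: eq_bigr => q _; apply/esym.
by rewrite [LHS](@lin_swout _ _ _ _ F^o _ _ (fun z : 'M_(_, _) => z p q)) //; prove_lin.
Qed.

Lemma pairingr_aver d d' (rho : 'I_n -> 'M[F]_d) (sigma : 'I_n -> 'M[F]_d') :
  chev (dmul H (charv rho) (dualch H (charv sigma))) e =
  \sum_p \sum_q averr rho sigma (delta_mx p q) p q.
Proof.
rewrite chev_dmul.
transitivity (\sum_p \sum_q sw H e (fun a b =>
   (repv rho a *m delta_mx p q *m repv sigma (S b)) p q : F^o)).
  transitivity (\sum_p sw H e (fun a b => \sum_q
     (repv rho (a) *m delta_mx p q *m repv sigma (S b)) p q : F^o)).
    rewrite -(@sw_sum F^o _ _ _ _ (fun p a b => \sum_q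
      (repv rho (a) *m delta_mx p q *m repv sigma (S b)) p q)).
    apply: (@eq_sw _ _ _ F^o) => a b.
    by rewrite chev_dualch !chev_charv mxtrace_delta.
  apply: eq_bigr => p _.
  by rewrite (@sw_sum F^o _ _ _ _ (fun q a b =>
      (repv rho (a) *m delta_mx p q *m repv sigma (S b)) p q)).
apply: eq_bigr => p _; apply: eq_bigr => q _; apply/esym.
by rewrite [LHS](@lin_swout _ _ _ _ F^o _ _ (fun z : 'M_(_, _) => z p q)) //; prove_lin.
Qed.

Lemma averl1 d (rho : 'I_n -> 'M[F]_d) : is_rep_on H A rho -> averl rho rho 1%:M = 1%:M.
Proof.
move=> [r1 rM]; transitivity (sw H e (fun a b => repv rho (S a ** b))).
  apply: (eq_sw_in hA) => //; [prove_lin|prove_lin|move=> a b aA bA].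
  by rewrite mulmx1 rM // (antip_in hA).
by rewrite (@sw_antipl _ _ _ hH _ _ (fun z => repv rho z)) ?e1 ?scale1r ?r1 //; prove_lin.
Qed.

Lemma averr1 d (rho : 'I_n -> 'M[F]_d) : is_rep_on H A rho -> averr rho rho 1%:M = 1%:M.
Proof.
move=> [r1 rM]; transitivity (sw H e (fun a b => repv rho (a ** S b))).
  apply: (eq_sw_in hA) => //; [prove_lin|prove_lin|move=> a b aA bA].
  by rewrite mulmx1 rM // (antip_in hA).
by rewrite (@sw_antipr _ _ _ hH _ _ (fun z => repv rho z)) ?e1 ?scale1r ?r1 //; prove_lin.
Qed.

Lemma lin_averl d d' (rho : 'I_n -> 'M[F]_d) (sigma : 'I_n -> 'M[F]_d') : lin (averl rho sigma).
Proof. by rewrite /averl; prove_lin. Qed.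

Lemma lin_averr d d' (rho : 'I_n -> 'M[F]_d) (sigma : 'I_n -> 'M[F]_d') : lin (averr rho sigma).
Proof. by rewrite /averr; prove_lin. Qed.

End Integral.
End OnSubalgebra.
End Representations.

(** * Schur's lemma and constituents *)

Section Schur.
Variables (F : closedFieldType) (n : nat) (H : hopf_data F n).
Hypothesis hH : is_hopf H.
Local Notation vec := 'rV[F]_n.
Local Notation "x ** y" := (mulH H x y) (at level 40, left associativity).
Local Notation S := (antipH H).
Local Notation eps := (counitH H).
Local Notation one := (hunit H).

(** * Schur's lemma *)

Section Intertwiners.
Variable A : 'M[F]_n.

Lemma schur_char d d' (rho : 'I_n -> 'M[F]_d) (sigma : 'I_n -> 'M[F]_d') X :
  irreducible_on A rho -> irreducible_on A sigma ->
  (forall x, (x <= A)%MS -> repv rho x *m X = X *m repv sigma x) -> X != 0 ->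
  forall x, (x <= A)%MS -> chev (charv rho) x = chev (charv sigma) x.
Proof.
move=> [_ irho] [_ isig] hX X0.
have rk : \rank X = d.
  have [x xA||rk] := irho (kermx X).
  - by apply/sub_kermxP; rewrite -mulmxA hX // mulmxA mulmx_ker mul0mx.
  - by rewrite mxrank_ker; have := rank_leq_row X; lia.
  have : \rank X = 0%N by move: rk (rank_leq_row X); rewrite mxrank_ker; lia.
  by move/eqP; rewrite mxrank_eq0 (negbTE X0).
have rk' : \rank X = d'.
  have [x xA||] := isig <<X>>%MS.
  - by rewrite (eqmxMr _ (genmxE X)) genmxE -hX // submxMl.
  - by rewrite genmxE => /eqP; rewrite mxrank_eq0 (negbTE X0).
  by rewrite genmxE.
have dd : d = d' by rewrite -rk rk'.
case: d' / dd sigma X isig hX X0 rk rk' => sigma X _ hX _ rk _ x xA.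
have uX : X \in unitmx by rewrite -row_full_unit /row_full rk.
by rewrite !chev_charv -[repv rho x](mulmxK uX) hX // mxtrace_mulC mulmxA mulVmx // mul1mx.
Qed.

Lemma schur_scalar d (rho : 'I_n -> 'M[F]_d) X : irreducible_on A rho ->
  (forall x, (x <= A)%MS -> repv rho x *m X = X *m repv rho x) ->
  exists c, X = c%:M.
Proof.
move=> [d0 irho] hX.
have [c rc] : exists c, root (char_poly X) c.
  by apply/closed_rootP; rewrite size_char_poly; case: (d) d0.
exists c; apply/eqP; rewrite -subr_eq0 -mxrank_eq0.
move: rc; rewrite -eigenvalue_root_char /eigenvalue /eigenspace => ker0.
have [x xA||] := irho (kermx (X - c%:M)).
- apply/sub_kermxP; rewrite -mulmxA mulmxBr hX // mul_mx_scalar -mul_scalar_mx.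
  by rewrite -mulmxBl mulmxA mulmx_ker mul0mx.
- by move=> k0; case/negP: ker0; rewrite -mxrank_eq0 k0.
rewrite mxrank_ker => rk.
by rewrite -(subKn (rank_leq_row (X - c%:M))) rk subnn.
Qed.

(** By Schur's lemma B X = b(X) 1 with b linear. Only the terms p = q survive, and they add up to b
    of the sum of all E_pp, that is, to b(1) = 1. *)
Lemma trace_average d (rho : 'I_n -> 'M[F]_d) (B : 'M[F]_d -> 'M[F]_d) :
  irreducible_on A rho -> lin B -> B 1%:M = 1%:M ->
  (forall X x, (x <= A)%MS -> repv rho x *m B X = B X *m repv rho x) ->
  \sum_p \sum_q B (delta_mx p q) p q = 1.
Proof.
move=> irho lB B1 hB; have d0 : (0 < d)%N by case: irho.
pose i0 := Ordinal d0.
have BE X : B X = (B X i0 i0)%:M.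
  have [c cE] := schur_scalar irho (hB X).
  by rewrite cE mxE eqxx.
transitivity (\sum_p B (delta_mx p p) i0 i0).
  apply: eq_bigr => p _; rewrite (bigD1 p) //= {1}BE mxE eqxx mulr1n.
  rewrite big1 ?addr0 // => q qp; rewrite BE mxE eq_sym (negbTE qp).
  by rewrite mulr0n.
have e1 : \sum_p delta_mx p p = 1%:M :> 'M[F]_d.
  by rewrite [RHS]mx1_sum_delta.
by rewrite -summxE -lin_sum // e1 B1 mxE eqxx.
Qed.

End Intertwiners.

Definition integral_on (A : 'M[F]_n) (e : vec) :=
  [/\ (e <= A)%MS, eps e = 1, (forall x, (x <= A)%MS -> e ** x = eps x *: e)
    & (forall x, (x <= A)%MS -> x ** e = eps x *: e)].

(** * Orthogonality relations *)

Section OnSubalgebra.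
Variables (A : 'M[F]_n) (hA : is_hopf_subalg H A) (e : vec) (he : integral_on A e).

Lemma pairingl_same d (rho : 'I_n -> 'M[F]_d) : is_rep_on H A rho ->
  irreducible_on A rho -> chev (dmul H (dualch H (charv rho)) (charv rho)) e = 1.
Proof.
have [eA e1 er el] := he; move=> hr ir; rewrite (pairingl_aver H).
apply: (trace_average ir); first exact: lin_averl.
  exact: (averl1 hH hA).
by move=> X x xA; apply: (averl_inter hH hA).
Qed.

Lemma pairingr_same d (rho : 'I_n -> 'M[F]_d) : is_rep_on H A rho ->
  irreducible_on A rho -> chev (dmul H (charv rho) (dualch H (charv rho))) e = 1.
Proof.
have [eA e1 er el] := he; move=> hr ir; rewrite (pairingr_aver H).
apply: (trace_average ir); first exact: lin_averr.
  exact: (averr1 hH hA).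
by move=> X x xA; apply: (averr_inter hH hA).
Qed.

Lemma pairingl_inter d d' (rho : 'I_n -> 'M[F]_d) (sigma : 'I_n -> 'M[F]_d') :
  is_rep_on H A rho -> is_rep_on H A sigma ->
  chev (dmul H (dualch H (charv rho)) (charv sigma)) e != 0 ->
  exists2 X : 'M_(d, d'), X != 0 &
    forall x, (x <= A)%MS -> repv rho x *m X = X *m repv sigma x.
Proof.
have [eA e1 er el] := he; move=> hr hs; rewrite (pairingl_aver H) => sum0.
apply: NNPP => noX; move/eqP: sum0; apply.
apply: big1 => p _; apply: big1 => q _.
have [-> //|X0] := eqVneq (averl H e rho sigma (delta_mx p q)) 0; first by rewrite mxE.
case: noX; exists (averl H e rho sigma (delta_mx p q)) => // x xA.
exact: (averl_inter hH hA).
Qed.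

Lemma pairingr_inter d d' (rho : 'I_n -> 'M[F]_d) (sigma : 'I_n -> 'M[F]_d') :
  is_rep_on H A rho -> is_rep_on H A sigma ->
  chev (dmul H (charv rho) (dualch H (charv sigma))) e != 0 ->
  exists2 X : 'M_(d, d'), X != 0 &
    forall x, (x <= A)%MS -> repv rho x *m X = X *m repv sigma x.
Proof.
have [eA e1 er el] := he; move=> hr hs; rewrite (pairingr_aver H) => sum0.
apply: NNPP => noX; move/eqP: sum0; apply.
apply: big1 => p _; apply: big1 => q _.
have [-> //|X0] := eqVneq (averr H e rho sigma (delta_mx p q)) 0; first by rewrite mxE.
case: noX; exists (averr H e rho sigma (delta_mx p q)) => // x xA.
exact: (averr_inter hH hA).
Qed.

End OnSubalgebra.

(** * Irreducible constituents over a Hopf subalgebra *)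

Section Constituents.
Variable A : 'M[F]_n.
Hypothesis hA : is_hopf_subalg H A.

(** One half of [res_meet]. Being stated through characters, it is met by a factor occurring
    anywhere in a composition series. *)
Definition contains d (theta : 'I_n -> 'M[F]_d) (chi : vec) :=
  exists d1 (tau : 'I_n -> 'M[F]_d1), is_rep_on H A tau /\
    forall x, (x <= A)%MS -> chev chi x = chev (charv theta) x + chev (charv tau) x.

(** E projects onto a proper nonzero stable subspace. It need not commute with the action: [rho]
    only becomes block triangular, which suffices for characters. *)
Lemma reducible_split d (rho : 'I_n -> 'M[F]_d) :
  is_rep_on H A rho -> (0 < d)%N -> ~ irreducible_on A rho ->
  exists E : 'M[F]_d,
    [/\ E *m E = E, (forall x, (x <= A)%MS -> E *m repv rho x *m E = E *m repv rho x),
        (\rank E < d)%N & (\rank (1%:M - E)%R < d)%N].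
Proof.
move=> hr d0 nirr.
have [U UA [r0 rd]] : exists2 U : 'M[F]_d,
    (forall h, (h <= A)%MS -> (U *m repv rho h <= U)%MS) & \rank U <> 0%N /\ \rank U <> d.
  apply: NNPP => noU; apply: nirr; split=> // U UA.
  apply: NNPP => /not_or_and r; apply: noU; by exists U.
have UE : U *m proj_on U = U by rewrite proj_on_id.
have EU : (proj_on U <= U)%MS by rewrite submxMl.
have rE : \rank (proj_on U) = \rank U.
  by apply/anti_leq; rewrite mxrankS //= -{1}UE mxrankM_maxr.
have EE : proj_on U *m proj_on U = proj_on U by rewrite proj_on_id.
have ltU : (\rank U < d)%N by have := rank_leq_row U; lia.
exists (proj_on U); rewrite rE; split=> //.
  move=> x xA; rewrite proj_on_id //.
  by rewrite (submx_trans _ (UA _ xA)) // submxMr.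
have : proj_on U *m (1%:M - proj_on U) = 0 by rewrite mulmxBr mulmx1 EE subrr.
move/mulmx0_rank_max; rewrite rE addnC => le; apply: leq_trans le.
by rewrite -addn1 leq_add2l lt0n; apply/eqP.
Qed.

Lemma comp_reps_on d (rho : 'I_n -> 'M[F]_d) (E : 'M[F]_d) : is_rep_on H A rho ->
  E *m E = E -> (forall x, (x <= A)%MS -> E *m repv rho x *m E = E *m repv rho x) ->
  is_rep_on H A (comp_rep rho E) /\ is_rep_on H A (comp_rep rho (1%:M - E)).
Proof.
move=> hr EE hE; split; apply: comp_rep_on => //.
- by move=> h g hhA gA; rewrite hE.
- by rewrite mulmxBl mul1mx mulmxBr mulmx1 EE subrr subr0.
move=> h g hhA gA; set Q := 1%:M - E.
rewrite -!mulmxA; congr (_ *m _); congr (_ *m _).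
have EQ : E *m (repv rho g *m Q) = 0.
  by rewrite mulmxA mulmxBr mulmx1 hE // subrr.
by rewrite {1}/Q mulmxBl EQ mul1mx subr0.
Qed.

Lemma char_decomp d (rho : 'I_n -> 'M[F]_d) : is_rep_on H A rho ->
  exists2 s : seq vec, charv rho = \sum_(chi <- s) chi &
    forall chi, chi \in s -> exists d' (sigma : 'I_n -> 'M[F]_d'),
      [/\ is_rep_on H A sigma, irreducible_on A sigma & chi = charv sigma].
Proof.
have [N] := ubnP d; elim: N d rho => // N IH d rho dN hr.
have [d0|d0] := posnP d.
  exists nil => //; rewrite big_nil; apply/rowP => i; rewrite !mxE.
  by apply: big1 => -[k kd] _; exfalso; move: (kd); rewrite d0.
have [irr|nirr] := classic (irreducible_on A rho).
  exists [:: charv rho]; first by rewrite big_seq1.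
  by move=> chi; rewrite inE => /eqP ->; exists d, rho.
have [E [EE hE r1 r2]] := reducible_split hr d0 nirr.
have [hr1 hr2] := comp_reps_on hr EE hE.
have [|s1 e1 h1] := IH _ _ _ hr1; first by lia.
have [|s2 e2 h2] := IH _ _ _ hr2; first by lia.
exists (s1 ++ s2); first by rewrite (charv_split rho EE) e1 e2 big_cat.
by move=> chi; rewrite mem_cat => /orP[/h1|/h2].
Qed.

Lemma contains_add d (theta : 'I_n -> 'M[F]_d) d1 (tau : 'I_n -> 'M[F]_d1) chi :
  is_rep_on H A tau -> contains theta chi -> contains theta (chi + charv tau).
Proof.
move=> ht [d2 [tau' [ht' e]]]; exists (d2 + d1)%N, (sum_rep tau' tau).
split; first exact: sum_rep_on.
have chevD (a b : vec) x : chev (a + b) x = chev a x + chev b x.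
  by rewrite /chev -big_split; apply: eq_bigr => i _; rewrite mxE mulrDr.
by move=> x xA; rewrite charv_sum !chevD e // addrA.
Qed.

Lemma contains_self d (theta : 'I_n -> 'M[F]_d) chi :
  (forall x, (x <= A)%MS -> chev chi x = chev (charv theta) x) -> contains theta chi.
Proof.
(* The remaining summand is the representation of dimension zero. *)
move=> e; exists 0%N, (fun=> 0); split.
  by split=> [|h g _ _]; apply/matrixP; case.
move=> x xA; rewrite e // [X in _ + X]big1 ?addr0 // => i _.
by rewrite mxE /mxtrace big_ord0 mulr0.
Qed.

(** Induction on the sum of the dimensions. If [rho] is reducible, X is nonzero on the stable
    subspace or factors through the quotient. If [sigma] is reducible, X stays nonzero in the
    quotient or lands in the stable subspace. Between irreducibles X forces equal characters. *)
Lemma common_constituent d d' (rho : 'I_n -> 'M[F]_d) (sigma : 'I_n -> 'M[F]_d') X :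
  is_rep_on H A rho -> is_rep_on H A sigma -> X != 0 ->
  (forall x, (x <= A)%MS -> repv rho x *m X = X *m repv sigma x) ->
  exists d1 (theta : 'I_n -> 'M[F]_d1), [/\ is_rep_on H A theta, irreducible_on A theta,
    contains theta (charv rho) & contains theta (charv sigma)].
Proof.
have [N] := ubnP (d + d'); elim: N d d' rho sigma X => // N IH d d' rho sigma X dN hr hs X0 hX.
have d0 : (0 < d)%N.
  by case: d rho X hr hX X0 {dN} => // rho X _ _; rewrite [X]flatmx0 eqxx.
have d'0 : (0 < d')%N.
  by case: d' sigma X hs hX X0 {dN} => // sigma X _ _; rewrite [X]thinmx0 eqxx.
have [ir|nir] := classic (irreducible_on A rho); last first.
  have [E [EE hE r1 r2]] := reducible_split hr d0 nir.
  have [hr1 hr2] := comp_reps_on hr EE hE.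
  have [RX|RX] := eqVneq (row_base E *m X) 0.
    have EX := row_base0 RX.
    have QQ : (1%:M - E) *m (1%:M - E) = 1%:M - E.
      by rewrite mulmxBl mul1mx mulmxBr mulmx1 EE subrr subr0.
    have QX : (1%:M - E) *m X = X by rewrite mulmxBl EX mul1mx subr0.
    have [||x xA|d1 [th [ht it c1 c2]]] := IH _ _ (comp_rep rho (1%:M - E)) sigma
       (row_base (1%:M - E) *m X) _ hr2 hs.
    - by lia.
    - by apply: contraNneq X0 => /row_base0; rewrite QX => ->.
    - rewrite repv_comp mulmxA -(mulmxA _ (col_base _) (row_base _)) mulmx_base.
      by rewrite -mulmxA QX -mulmxA hX // mulmxA.
    exists d1, th; split=> //; rewrite (charv_split rho EE) addrC.
    exact: contains_add.
  have [||x xA|d1 [th [ht it c1 c2]]] := IH _ _ (comp_rep rho E) sigma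
     (row_base E *m X) _ hr1 hs.
  - by lia.
  - by [].
  - rewrite repv_comp mulmxA -(mulmxA _ (col_base _) (row_base _)) mulmx_base.
    have -> : row_base E *m repv rho x *m E = row_base E *m repv rho x.
      rewrite -{1}(row_baseE EE) -(mulmxA (row_base E) E) -(mulmxA (row_base E)) hE //.
      by rewrite mulmxA row_baseE.
    by rewrite -mulmxA hX // mulmxA.
  exists d1, th; split=> //; rewrite (charv_split rho EE).
  exact: contains_add.
have [isg|nis] := classic (irreducible_on A sigma); last first.
  have [E [EE hE r1 r2]] := reducible_split hs d'0 nis.
  have [hs1 hs2] := comp_reps_on hs EE hE.
  have QQ : (1%:M - E) *m (1%:M - E) = 1%:M - E.
    by rewrite mulmxBl mul1mx mulmxBr mulmx1 EE subrr subr0.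
  have [XC|XC] := eqVneq (X *m col_base (1%:M - E)) 0.
    have XE : X *m E = X.
      by have := col_base0 XC; rewrite mulmxBr mulmx1 => /eqP; rewrite subr_eq0 => /eqP.
    have [||x xA|d1 [th [ht it c1 c2]]] := IH _ _ rho (comp_rep sigma E)
       (X *m col_base E) _ hr hs1.
    - by lia.
    - by apply: contraNneq X0 => /col_base0; rewrite XE => ->.
    - rewrite repv_comp; move: (row_base E) (col_base E) (mulmx_base E) => R C CR.
      by rewrite !mulmxA hX // -(mulmxA X C) CR XE.
    exists d1, th; split=> //; rewrite (charv_split sigma EE).
    exact: contains_add.
  have [||x xA|d1 [th [ht it c1 c2]]] := IH _ _ rho (comp_rep sigma (1%:M - E))
     (X *m col_base (1%:M - E)) _ hr hs2.
  - by lia.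
  - by [].
  - rewrite repv_comp; set Q := 1%:M - E in QQ *.
    move: (row_base Q) (col_base Q) (mulmx_base Q) (col_baseE QQ) => R C CR QC.
    rewrite !mulmxA hX // -(mulmxA X C) CR.
    have EQ : E *m repv sigma x *m C = 0.
      by rewrite -QC mulmxA /Q mulmxBr mulmx1 hE // subrr mul0mx.
    by rewrite /Q mulmxBr mulmx1 !mulmxBl -!(mulmxA X) mulmxA EQ mulmx0 subr0.
  exists d1, th; split=> //; rewrite (charv_split sigma EE) addrC.
  exact: contains_add.
exists d', sigma; split=> //; apply: contains_self => // x xA.
exact: (schur_char ir isg hX).
Qed.

End Constituents.
End Schur.

(** * Perron-Frobenius *)

Lemma finite_choice (I : eqType) (T : Type) (t0 : T) (r : seq I) (P : I -> T -> Prop) :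
  (forall i, i \in r -> exists t, P i t) -> exists f, forall i, i \in r -> P i (f i).
Proof.
elim: r => [|i r IH] hP; first by exists (fun=> t0).
have [f hf] := IH (fun j jr => hP j (mem_behead (s := i :: r) jr)).
have [t ht] := hP i (mem_head _ _).
exists (fun j => if j == i then t else f j) => j; rewrite inE.
by case: eqVneq => [->|_] //= jr; apply: hf.
Qed.

(* Perron-Frobenius: at the index minimizing [w / v], the eigenvector equations
   for [w] and [v] leave a vanishing sum of nonnegative terms. *)
Lemma positive_eigenvectors (I : eqType) (r : seq I) (M : I -> I -> rat) (v w : I -> rat) c :
  (forall i, i \in r -> 0 < v i) -> (forall i j, i \in r -> j \in r -> 0 < M i j) ->
  (forall i, i \in r -> \sum_(j <- r) M i j * v j = c * v i) ->
  (forall i, i \in r -> \sum_(j <- r) M i j * w j = c * w i) ->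
  exists l, forall i, i \in r -> w i = l * v i.
Proof.
move=> v0 M0 Mv Mw.
have [->|] := eqVneq r nil; first by exists 0.
case Er : r => [//|i0 r'] _.
have [k kr kmin] : exists2 k, k \in r & forall j, j \in r -> w k / v k <= w j / v j.
  have: r != nil by rewrite Er.
  elim: (r) => // i s IH _; have [->|/IH[k ks kmin]] := eqVneq s nil.
    by exists i => [|j]; rewrite inE ?eqxx // => /eqP->.
  have [le|/ltW le] := leP (w i / v i) (w k / v k); last first.
    exists k; first by rewrite inE ks orbT.
    by move=> j; rewrite inE => /predU1P[->//|]; apply: kmin.
  exists i; first by rewrite inE eqxx.
  by move=> j; rewrite inE => /predU1P[->//|/kmin]; apply: le_trans.
rewrite -Er in v0 M0 Mv Mw *; exists (w k / v k) => i ir.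
have ge0 j : j \in r -> 0 <= M k j * (w j * v k - w k * v j).
  move=> jr; rewrite mulr_ge0 ?(ltW (M0 _ _ kr jr)) // subr_ge0.
  have := kmin j jr; rewrite ler_pdivrMr ?v0 // mulrAC ler_pdivlMr ?v0 //.
have s0 : \sum_(j <- r) M k j * (w j * v k - w k * v j) = 0.
  transitivity ((\sum_(j <- r) M k j * w j) * v k - w k * (\sum_(j <- r) M k j * v j)).
    rewrite mulr_suml mulr_sumr -sumrB; apply: eq_bigr => j _.
    by rewrite mulrBr !mulrA (mulrC (w k)).
  by rewrite Mv // Mw //; rewrite mulrCA mulrA subrr.
move/eqP: s0; rewrite big_seq psumr_eq0 // => /allP/(_ i ir); rewrite ir /=.
rewrite mulf_eq0 gt_eqF ?M0 //= subr_eq0 => /eqP e.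
by apply: (mulIf (lt0r_neq0 (v0 _ kr))); rewrite e mulrAC divfK // lt0r_neq0 // v0.
Qed.

(** The reduced fraction numq / denq defining [ratr] is compared with p / q by cross-multiplication
    over the integers; characteristic zero keeps the denominators invertible in F. *)
Lemma ratr_frac (F : fieldType) (p q : nat) : [pchar F] =i pred0 -> (0 < q)%N ->
  ratr (p%:R / q%:R) = p%:R / q%:R :> F.
Proof.
move=> /pcharf0P F0 q0; set x : rat := _ / _.
have z0 (z : int) : z != 0 -> z%:~R != 0 :> F.
  by case: z => m m0; rewrite ?NegzE ?rmorphN ?oppr_eq0 /= -pmulrn F0 //; move: m0; rewrite ?NegzE ?oppr_eq0.
have q0F : q%:R != 0 :> F by rewrite F0; lia.
have xq : x * q%:R = p%:R by rewrite divfK // pnatr_eq0; lia.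
rewrite /ratr; apply/eqP; rewrite eqr_div ?z0 ?denq_neq0 //; apply/eqP.
have : numq x * q%:Z = p%:Z * denq x.
  apply: (@intr_inj rat); rewrite !rmorphM /= -!pmulrn -xq.
  by rewrite -{2}(divq_num_den x) mulrAC divfK // intr_eq0 denq_neq0.
by move/(congr1 (fun z : int => z%:~R : F)); rewrite !rmorphM /= -!pmulrn.
Qed.

(** * The character algebra *)

Section DualAlgebra.
Variables (F : fieldType) (n : nat) (H : hopf_data F n).
Hypothesis hH : is_hopf H.
Local Notation vec := 'rV[F]_n.
Local Notation "f ## g" := (dmul H f g) (at level 40, left associativity).
Local Notation dual := (dualch H).

Lemma lin_chevl (x : vec) : lin (fun f : vec => chev f x : F^o).
Proof.
apply: lin_bigsum => i; apply: lin_mulFr.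
by apply: lin_entry; apply: lin_id.
Qed.

Lemma chevD f g (x : vec) : chev (f + g) x = chev f x + chev g x.
Proof. exact: (linD f g (lin_chevl x)). Qed.

Lemma chevZ a f (x : vec) : chev (a *: f) x = a * chev f x.
Proof. exact: (linZ a f (lin_chevl x)). Qed.

Lemma chev_sum I (r : seq I) P E (x : vec) :
  chev (\sum_(i <- r | P i) E i) x = \sum_(i <- r | P i) chev (E i) x.
Proof. exact: (lin_sum r P E (lin_chevl x)). Qed.

Lemma bilin_dmul : bilin (dmul H).
Proof.
split=> g a x y; apply: chev_inj => h; rewrite chevD chevZ !chev_dmul.
  rewrite /sw /swm mulr_sumr -big_split; apply: eq_bigr => i _ /=.
  rewrite mulr_sumr -big_split; apply: eq_bigr => j _ /=.
  by rewrite chevD chevZ /GRing.scale /=; ring.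
rewrite /sw /swm mulr_sumr -big_split; apply: eq_bigr => i _ /=.
rewrite mulr_sumr -big_split; apply: eq_bigr => j _ /=.
by rewrite chevD chevZ /GRing.scale /=; ring.
Qed.

Lemma dmulDl f g h : (f + g) ## h = f ## h + g ## h.
Proof. exact: (linD f g (bilin_dmul.1 h)). Qed.
Lemma dmulDr f g h : h ## (f + g) = h ## f + h ## g.
Proof. exact: (linD f g (bilin_dmul.2 h)). Qed.
Lemma dmulZl a f g : (a *: f) ## g = a *: (f ## g).
Proof. exact: (linZ a f (bilin_dmul.1 g)). Qed.
Lemma dmulZr a f g : f ## (a *: g) = a *: (f ## g).
Proof. exact: (linZ a g (bilin_dmul.2 f)). Qed.
Lemma dmul_suml I (r : seq I) P E g :
  (\sum_(i <- r | P i) E i) ## g = \sum_(i <- r | P i) E i ## g.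
Proof. exact: (lin_sum r P E (bilin_dmul.1 g)). Qed.
Lemma dmul_sumr I (r : seq I) P E g :
  g ## (\sum_(i <- r | P i) E i) = \sum_(i <- r | P i) g ## E i.
Proof. exact: (lin_sum r P E (bilin_dmul.2 g)). Qed.

Lemma dualD f g : dual (f + g) = dual f + dual g.
Proof. by apply: chev_inj => x; rewrite !(chevD, chev_dualch). Qed.

Lemma dmulA f g h : f ## (g ## h) = f ## g ## h.
Proof.
apply: chev_inj => x; rewrite !chev_dmul.
transitivity (sw H x (fun a b => sw H b (fun c d =>
   chev f a * (chev g c * chev h d) : F^o))).
  apply: (@eq_sw _ _ _ F^o) => a b; rewrite chev_dmul.
  by rewrite [LHS](@lin_swout _ _ _ F^o F^o _ _ (fun z => chev f a * z)) //; prove_lin.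
rewrite -(sw_coassoc hH x (fun a c d => chev f a * (chev g c * chev h d) : F^o)).
apply: (@eq_sw _ _ _ F^o) => a b; rewrite chev_dmul.
rewrite [RHS](@lin_swout _ _ _ F^o F^o _ _ (fun z => z * chev h b)); last by prove_lin.
by apply: (@eq_sw _ _ _ F^o) => c d; rewrite mulrA.
Qed.

Lemma dmul1f f : epsv H ## f = f.
Proof.
apply: chev_inj => x; rewrite chev_dmul.
have lf : lin (chev f : vec -> F^o) by prove_lin.
rewrite -[RHS](@sw_counitl _ _ _ hH F^o x _ lf).
by apply: (@eq_sw _ _ _ F^o) => a b; rewrite chev_epsv.
Qed.

Lemma dual_epsv : dual (epsv H) = epsv H.
Proof. by apply: chev_inj => x; rewrite chev_dualch !chev_epsv (eps_antip hH). Qed.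

Lemma deg_dmul f g : chev (f ## g) (hunit H) = chev f (hunit H) * chev g (hunit H).
Proof. by rewrite chev_dmul (sw_one hH) //; prove_lin. Qed.

Lemma deg_dual f : chev (dual f) (hunit H) = chev f (hunit H).
Proof. by rewrite chev_dualch (antip1 hH). Qed.

End DualAlgebra.

(** * Orthonormal irreducible characters, duality and multiplicities *)

Section FusionRules.
Variables (F : closedFieldType) (n : nat) (H : hopf_data F n).
Hypotheses (hF : [pchar F] =i pred0) (hH : is_hopf H).
Local Notation vec := 'rV[F]_n.
Local Notation "x ** y" := (mulH H x y) (at level 40, left associativity).
Local Notation "f ## g" := (dmul H f g) (at level 40, left associativity).
Local Notation dual := (dualch H).
Local Notation S := (antipH H).
Local Notation eps := (counitH H).
Local Notation one := (hunit H).
Local Notation deg chi := (chev chi (hunit H)).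

Lemma natr_injF (p q : nat) : p%:R = q%:R :> F -> p = q.
Proof.
move=> e; wlog le : p q e / (p <= q)%N.
  by move=> W; case: (leqP p q) => [/W->//|/ltnW/W->].
have : (q - p)%:R = 0 :> F by rewrite natrB // e subrr.
by move/eqP; rewrite ((pcharf0P F).1 hF); lia.
Qed.

Variables (irr : seq vec) (irr_uniq : uniq irr).
Hypothesis irrP : forall chi, chi \in irr <-> is_irr_char H chi.
Variable L : vec.
Hypothesis hL : integral_on H 1%:M L.
Local Notation tau f := (chev f L).

Let rep_of chi : chi \in irr -> exists d (rho : 'I_n -> 'M[F]_d),
  [/\ is_rep_on H 1%:M rho, irreducible_on 1%:M rho & chi = charv rho].
Proof. by move/irrP. Qed.

Lemma irr_orthol chi psi : chi \in irr -> psi \in irr ->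
  tau (dual chi ## psi) = (chi == psi)%:R.
Proof.
move=> /rep_of[d [rho [hr ir ->]]] hpsi.
have [<-|ne] := eqVneq; first by apply: (pairingl_same hH (hopf_subalg1 H) hL).
case/rep_of: hpsi ne => d' [sigma [hs is_ ->]] ne.
apply/eqP; apply: contraNT ne.
move/(pairingl_inter hH (hopf_subalg1 H) hL hr hs) => [X X0 hX].
apply/eqP; apply: chev_inj => h.
by apply: (schur_char ir is_ hX X0); apply: submx1.
Qed.

Lemma irr_orthor chi psi : chi \in irr -> psi \in irr ->
  tau (chi ## dual psi) = (chi == psi)%:R.
Proof.
move=> /rep_of[d [rho [hr ir ->]]] hpsi.
have [<-|ne] := eqVneq; first by apply: (pairingr_same hH (hopf_subalg1 H) hL).
case/rep_of: hpsi ne => d' [sigma [hs is_ ->]] ne.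
apply/eqP; apply: contraNT ne.
move/(pairingr_inter hH (hopf_subalg1 H) hL hr hs) => [X X0 hX].
apply/eqP; apply: chev_inj => h.
by apply: (schur_char ir is_ hX X0); apply: submx1.
Qed.

(** If U is stable under the dual representation, its annihilator [kermx U^T] is stable under all
    rho(S h), hence under all of rho because S is onto. *)
Lemma irr_dual chi : chi \in irr -> dual chi \in irr.
Proof.
move=> /rep_of[d [rho [hr [d0 ir] ->]]]; apply/irrP.
exists d, (dual_rep H rho); split; [exact: dual_rep_on (hopf_subalg1 H) _ _ _| |by rewrite charv_dual].
have [_ L1 _ lL] := hL.
have Sfull : row_full (hanti H).
  apply: (antip_surj hH (L := L)); last by move=> x; apply: lL; apply: submx1.
  apply/eqP => L0; move: L1; rewrite L0.
  have -> : eps 0 = 0 by apply: big1 => i _; rewrite mxE mul0r.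
  by move/eqP; rewrite eq_sym oner_eq0.
split=> // U hU.
have [x _||] := ir (kermx U^T).
- have /submxP[h ->] : (x <= hanti H)%MS by apply: submx_full.
  apply/sub_kermxP; have /submxP[D] := hU h (submx1 _).
  rewrite repv_dual => /(congr1 trmx); rewrite !trmx_mul trmxK /antipH => e.
  by rewrite -mulmxA e mulmxA mulmx_ker mul0mx.
- by rewrite mxrank_ker mxrank_tr; have := rank_leq_row U; lia.
- by rewrite mxrank_ker mxrank_tr; have := rank_leq_row U; lia.
Qed.

Lemma dualK chi : chi \in irr -> dual (dual chi) = chi.
Proof.
move=> hchi; have hd := irr_dual hchi.
have := irr_orthor hd hd; rewrite eqxx (irr_orthol hchi (irr_dual hd)).
by case: eqVneq => [<-//|_] /eqP; rewrite eq_sym oner_eq0.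
Qed.

Lemma sum_dual (V : nmodType) (P : pred vec) (G : vec -> V) :
  \sum_(chi <- irr | P chi) G chi = \sum_(chi <- irr | P (dual chi)) G (dual chi).
Proof.
have inj : {in irr &, injective dual}.
  by move=> x y hx hy e; rewrite -(dualK hx) e dualK.
rewrite -[RHS](big_map dual P G); apply: perm_big.
apply: uniq_perm; rewrite ?map_inj_in_uniq // => x; apply/idP/mapP => [hx|[y hy ->]].
  by exists (dual x); rewrite ?dualK ?irr_dual.
exact: irr_dual.
Qed.

Definition is_char (f : vec) :=
  exists d (rho : 'I_n -> 'M[F]_d), is_rep_on H 1%:M rho /\ f = charv rho.

Lemma irr_char chi : chi \in irr -> is_char chi.
Proof. by case/rep_of => d [rho [hr _ ->]]; exists d, rho. Qed.

Lemma dmul_char f g : is_char f -> is_char g -> is_char (f ## g).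
Proof.
move=> [d [rho [hr ->]]] [d' [sigma [hs ->]]].
exists (d * d')%N, (tensor_rep H rho sigma); rewrite charv_tensor; split=> //.
exact: (tensor_rep_on hH (hopf_subalg1 H)).
Qed.

(** Natural coefficients, rather than arbitrary elements of the character algebra: closed under
    products, and the source of rationality and nonnegativity of the N. *)
Definition nchar (f : vec) :=
  exists m : vec -> nat, f = \sum_(psi <- irr) (m psi)%:R *: psi.

Lemma nchar0 : nchar 0.
Proof. by exists (fun=> 0%N); rewrite big1 // => i _; rewrite scale0r. Qed.

Lemma ncharD f g : nchar f -> nchar g -> nchar (f + g).
Proof.
move=> [m ->] [p ->]; exists (fun x => m x + p x)%N.
by rewrite -big_split; apply: eq_bigr => x _; rewrite natrD scalerDl.
Qed.

Lemma ncharZ k f : nchar f -> nchar (k%:R *: f).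
Proof.
move=> [m ->]; exists (fun x => k * m x)%N.
by rewrite scaler_sumr; apply: eq_bigr => x _; rewrite natrM scalerA.
Qed.

Lemma nchar_sum (I : eqType) (r : seq I) (P : pred I) (E : I -> vec) :
  (forall i, i \in r -> P i -> nchar (E i)) -> nchar (\sum_(i <- r | P i) E i).
Proof.
move=> hE; rewrite big_seq_cond; apply: big_ind; [exact: nchar0 | exact: ncharD|].
by move=> i /andP[]; apply: hE.
Qed.

Lemma nchar_irr chi : chi \in irr -> nchar chi.
Proof.
move=> hchi; exists (fun x => nat_of_bool (x == chi)).
rewrite (bigD1_seq chi) //= eqxx scale1r big1 ?addr0 // => x ne.
by rewrite (negbTE ne) scale0r.
Qed.

Lemma char_nchar f : is_char f -> nchar f.
Proof.
move=> [d [rho [hr ->]]]; have [s -> hs] := char_decomp hr.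
apply: nchar_sum => chi chis _; apply: nchar_irr; apply/irrP.
exact: hs.
Qed.

Lemma nchar_dmul f g : nchar f -> nchar g -> nchar (f ## g).
Proof.
move=> [m ->] [p ->]; rewrite dmul_suml; apply: nchar_sum => x xi _.
rewrite dmulZl; apply: ncharZ; rewrite dmul_sumr; apply: nchar_sum => y yi _.
rewrite dmulZr; apply: ncharZ; apply: char_nchar.
by apply: dmul_char; apply: irr_char.
Qed.

Lemma coefl (m : vec -> F) chi : chi \in irr ->
  tau (dual chi ## \sum_(psi <- irr) m psi *: psi) = m chi.
Proof.
move=> hchi; rewrite dmul_sumr chev_sum (bigD1_seq chi) //= dmulZr chevZ.
rewrite irr_orthol // eqxx mulr1 big_seq_cond big1 ?addr0 // => x /andP[xi ne].
by rewrite dmulZr chevZ irr_orthol // eq_sym (negbTE ne) mulr0.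
Qed.

Lemma coefr (m : vec -> F) chi : chi \in irr ->
  tau ((\sum_(psi <- irr) m psi *: psi) ## dual chi) = m chi.
Proof.
move=> hchi; rewrite dmul_suml chev_sum (bigD1_seq chi) //= dmulZl chevZ.
rewrite irr_orthor // eqxx mulr1 big_seq_cond big1 ?addr0 // => x /andP[xi ne].
by rewrite dmulZl chevZ irr_orthor // (negbTE ne) mulr0.
Qed.

Lemma nchar_expand f : nchar f -> f = \sum_(psi <- irr) tau (dual psi ## f) *: psi.
Proof.
move=> [m fE]; rewrite {1}fE big_seq [RHS]big_seq; apply: eq_bigr => x xi.
by rewrite fE (coefl (fun x => (m x)%:R)).
Qed.

Lemma tau_cyc f g : nchar f -> nchar g -> tau (f ## g) = tau (g ## f).
Proof.
move=> [m ->] [p ->]; rewrite dmul_suml dmul_sumr !chev_sum.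
rewrite big_seq [RHS]big_seq; apply: eq_bigr => x xi.
rewrite dmulZl dmulZr !chevZ; congr (_ * _); rewrite -(dualK xi).
rewrite (coefl (fun x => (p x)%:R)) ?(coefr (fun x => (p x)%:R)) //; exact: irr_dual.
Qed.

Lemma deg_nat chi : chi \in irr -> exists d : nat, (0 < d)%N /\ deg chi = d%:R.
Proof.
move=> /rep_of[d [rho [[r1 _] [d0 _] ->]]]; exists d; split=> //.
by rewrite chev_charv r1 mxtrace1.
Qed.

Lemma deg_neq0 chi : chi \in irr -> deg chi != 0.
Proof. by case/deg_nat => d [d0 ->]; rewrite ((pcharf0P F).1 hF) -lt0n. Qed.

Lemma epsv_irr : epsv H \in irr.
Proof.
apply/irrP; exists 1%N, (fun i => (hcounit H i)%:M).
have rE h : repv (fun i => (hcounit H i)%:M) h = (eps h)%:M :> 'M[F]_1.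
  rewrite /repv /counitH (raddf_sum (@scalar_mx F 1)).
  by apply: eq_bigr => i _; rewrite scale_scalar_mx.
split.
- by split=> [|h g _ _]; rewrite !rE ?(eps1 hH) // (epsM hH) scalar_mxM.
- split=> // U _; have := rank_leq_row U; case: (\rank U) => [|[|//]] _; by [left|right].
by apply/rowP => i; rewrite !mxE /mxtrace big_ord1 mxE eqxx.
Qed.

Lemma regular_absorb f : nchar f ->
  (\sum_(chi <- irr) deg chi *: chi) ## f = deg f *: \sum_(chi <- irr) deg chi *: chi.
Proof.
move=> hf; set d := \sum_(chi <- irr) deg chi *: chi.
have hd : nchar d.
  by apply: nchar_sum => x xi _; have [k [_ ->]] := deg_nat xi; apply/ncharZ/nchar_irr.
rewrite {2}/d scaler_sumr [LHS]nchar_expand; last exact: nchar_dmul.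
rewrite big_seq [RHS]big_seq; apply: eq_bigr => psi hpsi; rewrite scalerA; congr (_ *: _).
have hpsid := nchar_irr (irr_dual hpsi).
have hg := nchar_dmul hf hpsid.
rewrite tau_cyc //; last exact: nchar_dmul.
rewrite -(dmulA hH) -(deg_dual hH psi) -(deg_dmul hH) {1}/d.
rewrite (sum_dual xpredT) /= dmul_suml chev_sum {2}(nchar_expand hg) chev_sum.
rewrite big_seq [RHS]big_seq; apply: eq_bigr => x xi.
by rewrite dmulZl !chevZ (deg_dual hH) mulrC.
Qed.

(** * Classes modulo K and multiplicities on K *)

Variables (K : 'M[F]_n) (hK : is_hopf_subalg H K) (e : vec).
Hypotheses (he : integral_on H K e) (eC : forall h, e ** h = h ** e).
Variables (s : nat) (cl : vec -> 'I_s.+1).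
Hypotheses
  (hcl_surj : forall i, exists2 chi, chi \in irr & cl chi = i)
  (hcl : forall chi mu, chi \in irr -> mu \in irr ->
           (cl chi = cl mu <-> res_meet H K chi mu))
  (hcl0 : cl (epsv H) = ord0).
Variable st : 'I_s.+1 -> 'I_s.+1.
Hypothesis hst : forall chi, chi \in irr -> cl (dual chi) = st (cl chi).

Local Notation mult mu chi := (chev (dual mu ## chi) e).

Lemma rep_restrict d (rho : 'I_n -> 'M[F]_d) : is_rep_on H 1%:M rho -> is_rep_on H K rho.
Proof. by move=> [r1 rM]; split=> // h g _ _; apply: rM; apply: submx1. Qed.

Lemma mult_nat_irr mu chi : mu \in irr -> chi \in irr ->
  exists m : nat, mult mu chi = m%:R.
Proof.
have [eK e1 er el] := he.
move=> /rep_of[d [rho [hr _ ->]]] /rep_of[d' [sigma [hs _ ->]]].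
by apply: (mult_nat hH hK) => //; apply: rep_restrict.
Qed.

Lemma mult_restrict (mu mu' chi chi' : vec) :
  (forall x, (x <= K)%MS -> chev mu x = chev mu' x) ->
  (forall x, (x <= K)%MS -> chev chi x = chev chi' x) -> mult mu chi = mult mu' chi'.
Proof.
have [eK e1 er el] := he; move=> hmu hchi; rewrite !chev_dmul.
apply: (@eq_sw_in _ _ _ _ hK F^o) => //; [prove_lin|prove_lin|move=> a b aK bK].
by rewrite !chev_dualch hmu ?(antip_in hK) // hchi.
Qed.

Lemma mult_neq0 mu chi : mu \in irr -> chi \in irr -> mult mu chi != 0 <-> cl mu = cl chi.
Proof.
move=> hmu hchi; have [eK e1 er el] := he; split.
  move=> m0; apply/hcl => //.
  case/rep_of: hmu m0 => d [rho [hr _ ->]]; case/rep_of: hchi => d' [sigma [hs _ ->]].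
  move/(pairingl_inter hH hK he (rep_restrict hr) (rep_restrict hs)) => [X X0 hX].
  have [d1 [th [ht it [d2 [t2 [ht2 e2]]] [d3 [t3 [ht3 e3]]]]]] :=
    common_constituent (rep_restrict hr) (rep_restrict hs) X0 hX.
  by exists d1, th; split=> //; [exists d2, t2 | exists d3, t3].
move/hcl => /(_ hmu hchi) [d [th [ht it [d2 [t2 [ht2 e2]]] [d3 [t3 [ht3 e3]]]]]].
(* On K both characters have the summand theta, so the pairing expands into 1 plus three natural
   numbers, nonzero in characteristic zero. *)
rewrite (@mult_restrict _ (charv th + charv t2) _ (charv th + charv t3)); last first.
- by move=> x xK; rewrite e3 // chevD.
- by move=> x xK; rewrite e2 // chevD.
rewrite (dualD H) dmulDl !dmulDr !chevD (pairingl_same hH hK he ht it).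
have [m1 ->] := mult_nat hH hK eK e1 er ht ht3.
have [m2 ->] := mult_nat hH hK eK e1 er ht2 ht.
have [m3 ->] := mult_nat hH hK eK e1 er ht2 ht3.
rewrite -[1]/(1%:R) -!natrD ((pcharf0P F).1 hF); lia.
Qed.

(** The central idempotent e acts on an irreducible module by a scalar c with c^2 = c. If its trace
    is nonzero then c = 1, and x e = eps(x) e shows that K acts through eps. *)
Lemma eval_e_trivial psi : psi \in irr -> chev psi e != 0 ->
  forall x, (x <= K)%MS -> chev psi x = eps x * deg psi.
Proof.
have [eK e1 er el] := he; move=> /rep_of[d [rho [hr ir ->]]] + x xK.
have [r1 rM] := hr; have [h|c cE] := schur_scalar (X := repv rho e) ir.
  by move=> _; rewrite -!rM ?submx1 // eC.
rewrite !chev_charv cE mxtrace_scalar => c0.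
have cc : (c * c)%:M = c%:M :> 'M[F]_d.
  by rewrite scalar_mxM -cE -rM ?submx1 // er // e1 scale1r.
have c1 : c%:M = 1%:M :> 'M[F]_d.
  have c00 : c != 0 by apply: contraNneq c0 => ->; rewrite mul0rn.
  by rewrite -[c in LHS](mulKf c00) -scale_scalar_mx cc scale_scalar_mx mulVf.
rewrite -[repv rho x]mulmx1 -c1 -cE -rM ?submx1 // el //.
rewrite (linZ _ _ (lin_repv (d := d) rho (@lin_id _ _))) cE c1 linearZ /=.
by rewrite r1.
Qed.

Lemma eval_e psi : psi \in irr -> chev psi e = if cl psi == ord0 then deg psi else 0.
Proof.
have [eK e1 er el] := he; move=> hpsi.
have E : mult (epsv H) psi = chev psi e by rewrite (dual_epsv hH) (dmul1f hH).
have [ce|ce] := eqVneq.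
  have n0 : chev psi e != 0.
    by rewrite -E; apply/mult_neq0; rewrite ?epsv_irr // hcl0.
  by rewrite (eval_e_trivial hpsi n0) // e1 mul1r.
apply/eqP; apply: contraNT ce; rewrite -E => /mult_neq0.
by rewrite hcl0 => ->; rewrite ?epsv_irr.
Qed.

(** * Class sums and multiplication by a_0 *)

Definition csum i := \sum_(chi <- irr | cl chi == i) deg chi *: chi.
Local Notation a0 := (csum ord0).

Lemma stK i : st (st i) = i.
Proof.
have [chi hchi <-] := hcl_surj i.
by rewrite -hst // -hst ?irr_dual // dualK.
Qed.

Lemma st0 : st ord0 = ord0.
Proof. by rewrite -hcl0 -hst ?epsv_irr // (dual_epsv hH) hcl0. Qed.

Lemma dual_csum k : \sum_(chi <- irr | cl chi == k) deg chi *: dual chi = csum (st k).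
Proof.
rewrite /csum [RHS]sum_dual big_seq_cond [RHS]big_seq_cond; apply: eq_big => chi.
  case: (boolP (chi \in irr)) => //= hchi.
  by rewrite hst // (can_eq stK).
by rewrite (deg_dual hH).
Qed.

Lemma csum_nchar i : nchar (csum i).
Proof.
by apply: nchar_sum => x xi _; have [k [_ ->]] := deg_nat xi; apply/ncharZ/nchar_irr.
Qed.

Lemma eval_e_tau f : nchar f -> chev f e = tau (a0 ## f).
Proof.
(* As 0^* = 0, a_0 is self-dual and may be written as a sum of duals, so that tau reads off the
   coefficients of f in A_0. *)
move=> [m fE]; rewrite -st0 -dual_csum dmul_suml chev_sum.
rewrite {1}fE chev_sum [RHS]big_mkcond big_seq [RHS]big_seq; apply: eq_bigr => x xi.
rewrite chevZ eval_e //; case: eqP => _; last by rewrite mulr0.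
by rewrite dmulZl chevZ fE (coefl (fun x => (m x)%:R)) // mulrC.
Qed.

Lemma mul_a0 chi : chi \in irr -> chi ## a0 = \sum_(mu <- irr) mult mu chi *: mu.
Proof.
move=> hchi; have hc := nchar_irr hchi; have h0 := csum_nchar ord0.
rewrite [LHS]nchar_expand; last exact: nchar_dmul.
rewrite big_seq [RHS]big_seq; apply: eq_bigr => mu hmu; congr (_ *: _).
have hm := nchar_irr (irr_dual hmu).
by rewrite (dmulA hH) tau_cyc // -?eval_e_tau //; apply: nchar_dmul.
Qed.

(** On K the character psi is psi(1) eps, and e lies in K, so (mu^* psi)(e) = psi(1) mu^*(e). This
    is psi(1) mu(1) for mu in A_0 and zero otherwise. *)
Lemma a0_absorb psi : psi \in irr -> cl psi = ord0 -> psi ## a0 = deg psi *: a0.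
Proof.
move=> hpsi c0; have [eK e1 er el] := he.
rewrite mul_a0 // /csum scaler_sumr [RHS]big_mkcond big_seq [RHS]big_seq.
apply: eq_bigr => mu hmu.
have -> : mult mu psi = deg psi * chev (dual mu) e.
  rewrite chev_dmul.
  transitivity (sw H e (fun a b => eps b *: (deg psi * chev (dual mu) a : F^o))).
    apply: (@eq_sw_in _ _ _ _ hK F^o) => //; [prove_lin|prove_lin|move=> a b aK bK].
    rewrite (eval_e_trivial hpsi) //; first by rewrite /GRing.scale /=; ring.
    by rewrite eval_e // c0 eqxx deg_neq0.
  by rewrite (@sw_counitr _ _ _ hH F^o e (fun a => deg psi * chev (dual mu) a)) //; prove_lin.
rewrite eval_e ?irr_dual // hst // (deg_dual hH) -{1}st0 (can_eq stK).
by case: eqP; rewrite ?mulr0 ?scale0r // scalerA.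
Qed.

Lemma deg_csum i : deg (csum i) = \sum_(chi <- irr | cl chi == i) deg chi * deg chi.
Proof. by rewrite chev_sum; apply: eq_bigr => x _; rewrite chevZ. Qed.

Lemma a0_idem : a0 ## a0 = deg a0 *: a0.
Proof.
rewrite {1}/csum dmul_suml deg_csum scaler_suml big_seq_cond [RHS]big_seq_cond.
apply: eq_bigr => x /andP[xi /eqP cx].
by rewrite dmulZl a0_absorb // scalerA.
Qed.

(** The coefficient of nu in [regular_absorb] for f = a_0: the degree vector is an eigenvector of
    the multiplicity matrix. *)
Lemma mult_deg nu : nu \in irr ->
  \sum_(chi <- irr) mult nu chi * deg chi = deg a0 * deg nu.
Proof.
move=> hnu; have := congr1 (fun f => tau (dual nu ## f)) (regular_absorb (csum_nchar ord0)).
rewrite /= dmulZr chevZ (coefl (fun x => deg x)) // => <-.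
rewrite dmul_suml dmul_sumr chev_sum big_seq [RHS]big_seq.
apply: eq_bigr => x xi; rewrite dmulZl dmulZr chevZ (mul_a0 xi) mulrC.
by rewrite (coefl (fun y => mult y x)).
Qed.

(** The coefficient of nu in chi a_0 a_0 = a_0(1) chi a_0: every column of the multiplicity matrix
    is an eigenvector for the same eigenvalue. *)
Lemma mult_idem nu chi : nu \in irr -> chi \in irr ->
  \sum_(mu <- irr) mult nu mu * mult mu chi = deg a0 * mult nu chi.
Proof.
move=> hnu hchi.
have : chi ## a0 ## a0 = deg a0 *: (chi ## a0) by rewrite -(dmulA hH) a0_idem dmulZr.
move/(congr1 (fun f => tau (dual nu ## f))).
rewrite /= (mul_a0 hchi) dmulZr chevZ (coefl (fun y => mult y chi)) // => <-.
rewrite dmul_suml dmul_sumr chev_sum big_seq [RHS]big_seq.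
apply: eq_bigr => x xi; rewrite dmulZl dmulZr chevZ (mul_a0 xi) mulrC.
by rewrite (coefl (fun y => mult y x)).
Qed.

Lemma deg_csum_neq0 i : deg (csum i) != 0.
Proof.
have [dg hdg] := finite_choice 0%N deg_nat.
have [chi hchi ci] := hcl_surj i.
have -> : deg (csum i) = (\sum_(x <- irr | cl x == i) dg x * dg x)%N%:R.
  rewrite deg_csum natr_sum big_seq_cond [RHS]big_seq_cond; apply: eq_bigr => x /andP[xi _].
  by rewrite natrM; case: (hdg x xi) => _ ->.
rewrite ((pcharf0P F).1 hF) sum_nat_seq_neq0; apply/hasP; exists chi => //.
by rewrite ci eqxx /=; case: (hdg chi hchi); lia.
Qed.

Lemma mult_prop chi mu : chi \in irr -> mu \in irr -> cl mu = cl chi ->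
  mult mu chi * deg chi = mult chi chi * deg mu.
Proof.
move=> hchi hmu cm.
have [dg hdg] := finite_choice 0%N deg_nat.
have hdgE x : x \in irr -> deg x = (dg x)%:R by move=> /hdg[].
have [M hM] : exists M : vec -> vec -> nat, forall x, x \in irr -> forall y, y \in irr ->
    mult x y = (M x y)%:R.
  apply: (@finite_choice _ (vec -> nat) (fun=> 0%N) irr
      (fun x f => forall y, y \in irr -> mult x y = (f y)%:R)) => x xi.
  by apply: (@finite_choice _ nat 0%N irr (fun y m => mult x y = m%:R)) => y yi; apply: mult_nat_irr.
have [c cE] : exists c : nat, deg a0 = c%:R.
  exists (\sum_(x <- irr | cl x == ord0) dg x * dg x)%N.
  rewrite deg_csum natr_sum big_seq_cond [RHS]big_seq_cond; apply: eq_bigr => x /andP[xi _].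
  by rewrite natrM hdgE.
pose r := [seq x <- irr | cl x == cl chi].
have rP x : x \in r = (x \in irr) && (cl x == cl chi) by rewrite mem_filter andbC.
(* Restricts an eigenvector equation to the class of [chi], since multiplicities across classes
   vanish, and moves it from F through the natural numbers to [rat]. *)
have sub_sum x (g : vec -> nat) (z : nat) : x \in r ->
    \sum_(y <- irr) mult x y * (g y)%:R = deg a0 * z%:R ->
    \sum_(y <- r) (M x y)%:R * (g y)%:R = c%:R * z%:R :> rat.
  rewrite rP => /andP[xi /eqP cx] E.
  have {}E : (\sum_(y <- irr | cl y == cl chi) M x y * g y)%N = (c * z)%N.
    apply: natr_injF; rewrite natrM -cE -E natr_sum big_mkcond big_seq [RHS]big_seq.
    apply: eq_bigr => y yi; rewrite natrM -hM //.
    case: eqP => // ne; case: (eqVneq (mult x y) 0) => [->|/mult_neq0]; first by rewrite mul0r.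
    by rewrite cx => /(_ xi yi) e'; case: ne.
  by rewrite big_filter -natrM -E natr_sum; apply: eq_bigr => y _; rewrite natrM.
(* Perron-Frobenius on this block, comparing the degree vector with the column of [chi]. *)
have [l hl] : exists l : rat, forall x, x \in r -> (M x chi)%:R = l * (dg x)%:R.
  apply: (@positive_eigenvectors _ r (fun x y => (M x y)%:R) (fun x => (dg x)%:R) _ c%:R).
  - by move=> x; rewrite rP => /andP[/hdg[d0 _] _]; rewrite ltr0n.
  - move=> x y; rewrite !rP => /andP[xi /eqP cx] /andP[yi /eqP cy].
    have : mult x y != 0 by apply/mult_neq0; rewrite // cx cy.
    by rewrite hM // ((pcharf0P F).1 hF) ltr0n lt0n.
  - move=> x xr; apply: sub_sum => //; move: xr; rewrite rP => /andP[xi _].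
    rewrite -hdgE // -mult_deg // big_seq [RHS]big_seq; apply: eq_bigr => y yi.
    by rewrite hdgE.
  move=> x xr; apply: (sub_sum _ (fun y => M y chi)) => //.
  move: xr; rewrite rP => /andP[xi _].
  rewrite -hM // -mult_idem // big_seq [RHS]big_seq; apply: eq_bigr => y yi.
  by rewrite (hM y yi chi).
have e1 := hl mu; have e2 := hl chi; rewrite rP hmu cm eqxx in e1; rewrite rP hchi eqxx in e2.
have {e1 e2} : (M mu chi * dg chi = M chi chi * dg mu)%N.
  apply/eqP; rewrite -(eqr_nat rat) !natrM e1 // e2 //.
  by rewrite mulrAC.
by rewrite !hM // !hdgE // -!natrM => ->.
Qed.

(** [mult_prop] makes chi a_0 a multiple of its class sum; evaluating both sides at 1 determines the
    factor. *)
Lemma class_mul chi : chi \in irr ->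
  chi ## a0 = (deg a0 * deg chi / deg (csum (cl chi))) *: csum (cl chi).
Proof.
move=> hchi; set l := mult chi chi / deg chi.
have E : chi ## a0 = l *: csum (cl chi).
  rewrite mul_a0 // /csum scaler_sumr [RHS]big_mkcond big_seq [RHS]big_seq.
  apply: eq_bigr => mu hmu; case: eqP => [cm|ne]; last first.
    case: (eqVneq (mult mu chi) 0) => [->|/mult_neq0]; first by rewrite scale0r.
    by move/(_ hmu hchi).
  by rewrite scalerA /l mulrAC -mult_prop // mulfK // deg_neq0.
rewrite E; congr (_ *: _).
have := congr1 (fun f => deg f) E; rewrite /= chevZ (deg_dmul hH) mulrC => ->.
by rewrite mulfK // deg_csum_neq0.
Qed.

Lemma csum_a0 j : csum j ## a0 = deg a0 *: csum j.
Proof.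
rewrite {1}/csum dmul_suml.
transitivity (\sum_(chi <- irr | cl chi == j)
   (deg chi * deg chi * (deg a0 / deg (csum j))) *: csum j).
  rewrite big_seq_cond [RHS]big_seq_cond; apply: eq_bigr => x /andP[xi /eqP cx].
  by rewrite dmulZl class_mul // cx scalerA; congr (_ *: _); ring.
rewrite -scaler_suml -mulr_suml -deg_csum mulrCA divff ?mulr1 //.
exact: deg_csum_neq0.
Qed.

(** Replace f by f a_0 / a_0(1), expand f into irreducibles, and let [class_mul] collapse each class
    to a multiple of its sum. *)
Lemma nchar_a0 f : f ## a0 = deg a0 *: f -> nchar f ->
  f = \sum_k ((\sum_(mu <- irr | cl mu == k) tau (dual mu ## f) * deg mu)
               / deg (csum k)) *: csum k.
Proof.
move=> fa hf; apply: (scalerI (deg_csum_neq0 ord0)); rewrite -fa.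
rewrite {1}(nchar_expand hf) dmul_suml scaler_sumr.
transitivity (\sum_(mu <- irr) (deg a0 * (tau (dual mu ## f) * deg mu / deg (csum (cl mu))))
                *: csum (cl mu)).
  rewrite big_seq [RHS]big_seq; apply: eq_bigr => mu hmu.
  by rewrite dmulZl class_mul // scalerA; congr (_ *: _); ring.
rewrite (partition_big cl xpredT) //=; apply: eq_bigr => k _.
transitivity (\sum_(mu <- irr | cl mu == k) (tau (dual mu ## f) * deg mu)
                *: ((deg a0 / deg (csum k)) *: csum k)).
  by apply: eq_bigr => mu /eqP <-; rewrite scalerA; congr (_ *: _); ring.
by rewrite -scaler_suml !scalerA; congr (_ *: _); ring.
Qed.

Lemma fusion_rules : exists N : 'I_s.+1 -> 'I_s.+1 -> 'I_s.+1 -> rat,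
  [/\ (forall i j k, 0 <= N i j k),
      (forall i j, csum i ## csum j = \sum_k ratr (N i j k) *: csum k) &
      (forall i j k, ratr (N i j k) * deg (csum k)
                     = ratr (N j (st k) (st i)) * deg (csum (st i)))].
Proof.
have [dg hdg] := finite_choice 0%N deg_nat.
have hdgE x : x \in irr -> deg x = (dg x)%:R by move=> /hdg[].
pose D k := (\sum_(x <- irr | cl x == k) dg x * dg x)%N.
have DE k : deg (csum k) = (D k)%:R.
  rewrite deg_csum natr_sum big_seq_cond [RHS]big_seq_cond; apply: eq_bigr => x /andP[xi _].
  by rewrite natrM hdgE.
have D0 k : (0 < D k)%N by rewrite lt0n -((pcharf0P F).1 hF) -DE deg_csum_neq0.
have hn i j : nchar (csum i ## csum j) by apply: nchar_dmul; apply: csum_nchar.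
have [m hm] := fin_all_exists (fun i => fin_all_exists (hn i)).
(* The coefficient supplied by [nchar_a0], written with the multiplicities m of a_i a_j and D k =
   a_k(1). It is a quotient of natural numbers, hence visibly rational and nonnegative. *)
pose N i j k : rat := (\sum_(mu <- irr | cl mu == k) m i j mu * dg mu)%N%:R / (D k)%:R.
have NE i j k : ratr (N i j k) =
    (\sum_(mu <- irr | cl mu == k) tau (dual mu ## (csum i ## csum j)) * deg mu)
    / deg (csum k) :> F.
  rewrite ratr_frac // DE; congr (_ / _); rewrite natr_sum big_seq_cond [RHS]big_seq_cond.
  apply: eq_bigr => x /andP[xi _]; rewrite natrM hdgE // hm.
  by rewrite (coefl (fun x => (m i j x)%:R)).
have Ntau i j k : ratr (N i j k) * deg (csum k) = tau (csum (st k) ## (csum i ## csum j)).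
  rewrite NE divfK ?deg_csum_neq0 // -dual_csum.
  move: (csum i ## csum j) => f; rewrite dmul_suml chev_sum.
  by apply: eq_bigr => mu _; rewrite dmulZl chevZ mulrC.
exists N; split=> [i j k|i j|i j k].
- by rewrite divr_ge0 ?ler0n.
- rewrite {1}(@nchar_a0 (csum i ## csum j)) //; last by rewrite -(dmulA hH) csum_a0 dmulZr.
  by apply: eq_bigr => k _; rewrite NE.
(* The two sides are tau(a_{k^*} a_i a_j) and, as i^** = i, tau(a_i a_j a_{k^*}). *)
by rewrite !Ntau stK tau_cyc ?(dmulA hH) //; apply: csum_nchar.
Qed.
End FusionRules.

Theorem theorem2p3 (F : closedFieldType) (hF : [pchar F] =i pred0)
  (n : nat) (H : hopf_data F n) (hH : is_hopf H) (hss : semisimple H)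
  (K : 'M[F]_n) (hK : is_hopf_subalg H K) (hKn : normal_subalg H K)
  (irr : seq 'rV[F]_n) (hirr_uniq : uniq irr)
  (hirr : forall chi, chi \in irr <-> is_irr_char H chi)
  (s : nat) (cl : 'rV[F]_n -> 'I_s.+1)
  (hcl_surj : forall i, exists2 chi, chi \in irr & cl chi = i)
  (hcl : forall chi mu, chi \in irr -> mu \in irr ->
           (cl chi = cl mu <-> res_meet H K chi mu))
  (hcl0 : cl (epsv H) = ord0)
  (st : 'I_s.+1 -> 'I_s.+1)
  (hst : forall chi, chi \in irr -> cl (dualch H chi) = st (cl chi)) :
  let a i := \sum_(chi <- irr | cl chi == i) chev chi (hunit H) *: chi in
  exists N : 'I_s.+1 -> 'I_s.+1 -> 'I_s.+1 -> rat,
    [/\ (forall i j k, 0 <= N i j k),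
        (forall i j, dmul H (a i) (a j) = \sum_k ratr (N i j k) *: a k) &
        (forall i j k, ratr (N i j k) * chev (a k) (hunit H)
                       = ratr (N j (st k) (st i)) * chev (a (st i)) (hunit H))].
Proof.
have [e [eK e1 eC eR]] := normal_integral hH hK hss hKn.
(* H is a normal Hopf subalgebra of itself, so the same lemma provides its integral. *)
have [L [L1 l1 LC LR]] := normal_integral hH (hopf_subalg1 H) hss (normal_subalg1 H).
apply: (@fusion_rules F n H hF hH irr hirr_uniq hirr L _ K hK e _ eC s cl hcl_surj hcl hcl0 st hst).
  by split=> // x xK; rewrite -LC LR.
by split=> // x xK; rewrite -eC eR.
Qed.
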